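(* Let $\mathcal{L}$ be a Banach Lie algebra. Then the following conditions are equivalent: (i) $\mathcal{L}$ is $\mathcal{F}$-semisimple, that is, $\mathcal{F}(\mathcal{L})=\{0\}$. (ii) $\mathcal{L}$ has a complete, lower finite-gap chain of closed Lie $2$-step subideals from $\{0\}$ to $\mathcal{L}$. (iii) $\mathcal{L}$ has a complete, lower finite-gap chain of closed Lie subalgebras from $\{0\}$ to $\mathcal{L}$. (iv) The set of all closed Lie $2$-step subideals of $\mathcal{L}$ is a $\mathfrak{p}$-complete, lower finite-gap family. (v) The set of all closed Lie subalgebras of $\mathcal{L}$ is a $\mathfrak{p}$-complete, lower finite-gap family.
   Context: A Banach Lie algebra is a complex Lie algebra $\mathcal{L}$ which is a Banach space in some norm such that, for some constant $t_{\mathcal{L}}>0$, $\|[a,b]\|\leq t_{\mathcal{L}}\|a\|\|b\|$ for all $a,b\in\mathcal{L}$. Frattini radical: for a Banach Lie algebra $\mathcal{L}$ let $P_{\mathfrak{J}}(\mathcal{L})$ be the intersection of all proper closed Lie ideals of finite codimension in $\mathcal{L}$ (and $P_{\mathfrak{J}}(\mathcal{L})=\mathcal{L}$ if there are none). Put $P_{\mathfrak{J}}^{0}(\mathcal{L})=\mathcal{L}$, $P_{\mathfrak{J}}^{\alpha+1}(\mathcal{L})=P_{\mathfrak{J}}(P_{\mathfrak{J}}^{\alpha}(\mathcal{L}))$, $P_{\mathfrak{J}}^{\alpha}(\mathcal{L})=\bigcap_{\alpha'<\alpha}P_{\mathfrak{J}}^{\alpha'}(\mathcal{L})$ for limit ordinals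 $\alpha$. This decreasing transfinite chain of closed Lie ideals stabilizes, and $\mathcal{F}(\mathcal{L})$ is its stable value. (Replacing ideals by subalgebras, maximal subalgebras, or maximal ideals, always proper, closed and of finite codimension, gives the same $\mathcal{F}$.) A Lie subalgebra $I$ of $\mathcal{L}$ is a $2$-step Lie subideal if it is a Lie ideal of some Lie ideal of $\mathcal{L}$. For a non-empty family $G$ of closed subspaces of a Banach space put $\mathfrak{p}(G)=\bigcap_{Y\in G}Y$ and $\mathfrak{s}(G)=\overline{\sum_{Y\in G}Y}$. $G$ is $\mathfrak{p}$-complete if $\mathfrak{s}(G)\in G$ and $\mathfrak{p}(G')\in G$ for every $\varnothing\neq G'\subseteq G$; it is $\mathfrak{s}$-complete if $\mathfrak{p}(G)\in G$ and $\mathfrak{s}(G')\in G$ for every $\varnothing\neq G'\subseteq G$; it is complete if it is both. $G$ is a lower finite-gap family if for each $Z\in G$ with $Z\neq\mathfrak{p}(G)$ there is $Y\in G$ with $Y\subset Z$ and $0<\dim(Z/Y)<\infty$. A chain is a family of closed subspaces linearly ordered by inclusion; a lower finite-gap chain is a chain which is a lower finite-gap family. A complete chain $C$ goes from $V$ to $W$ if $\mathfrak{p}(C)=V$ and $\mathfrak{s}(C)=W$. *)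

(* Defs.v *)
(* The field of complex numbers is R[i] for an arbitrary R : realType. *)
From HB Require Import structures.
From mathcomp Require Import all_boot all_order all_algebra.
From mathcomp Require Import complex.
From mathcomp Require Import all_classical all_reals all_analysis.

Set Implicit Arguments.
Unset Strict Implicit.
Unset Printing Implicit Defensive.
Import Order.TTheory GRing.Theory Num.Theory.
Import numFieldNormedType.Exports.

Local Open Scope classical_set_scope.
Local Open Scope ring_scope.
Local Open Scope complex_scope.

(* In R[i], 0 < t means that t is a positive real. *)
HB.mixin Record isBanachLie (R : realType) L of CompleteNormedModule R[i] L := {
  bracket : L -> L -> L;
  bracket_linearl : forall b : L, linear (bracket^~ b);
  bracket_linearr : forall a : L, linear (bracket a);
  bracketxx : forall a : L, bracket a a = 0;
  bracket_jacobi : forall a b c : L,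
    bracket a (bracket b c) + bracket b (bracket c a)
      + bracket c (bracket a b) = 0;
  bracket_bounded : exists2 t : R[i],
    0 < t & forall a b : L, `|bracket a b| <= t * `|a| * `|b|
}.

#[short(type="banachLieType")]
HB.structure Definition BanachLie (R : realType) :=
  {L of isBanachLie R L & CompleteNormedModule R[i] L}.

Section Families.
Context {K : numFieldType} {X : normedModType K}.
Implicit Types (Y Z V W : set X) (G C : set (set X)).

Definition is_subspace Y := submod_closed [in Y].

Definition is_closed_subspace Y := closed Y /\ is_subspace Y.

(* For subspaces Y `<=` Z: the classes of e form a basis of Z / Y. *)
Definition quotient_dim Z Y (n : nat) := exists e : 'I_n -> X,
  [/\ forall i, Z (e i),
      forall c : 'I_n -> K, Y (\sum_i c i *: e i) -> forall i, c i = 0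
    & forall z, Z z -> exists c : 'I_n -> K, Y (z - \sum_i c i *: e i)].

Definition subspace_family G :=
  G !=set0 /\ forall Y, G Y -> is_closed_subspace Y.

Definition family_inf G : set X := \bigcap_(Y in G) Y.

Definition family_sum G : set X :=
  [set x | exists (n : nat) (v : 'I_n -> X),
    (forall i, exists2 Y, G Y & Y (v i)) /\ x = \sum_i v i].

Definition family_sup G : set X := closure (family_sum G).

Definition p_complete G :=
  [/\ subspace_family G, G (family_sup G)
    & forall G', G' !=set0 -> G' `<=` G -> G (family_inf G')].

Definition s_complete G :=
  [/\ subspace_family G, G (family_inf G)
    & forall G', G' !=set0 -> G' `<=` G -> G (family_sup G')].

Definition complete_family G := p_complete G /\ s_complete G.

Definition lower_finite_gap G :=
  subspace_family G /\
  forall Z, G Z -> Z <> family_inf G ->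
    exists Y, [/\ G Y, Y `<=` Z & exists2 n, (0 < n)%N & quotient_dim Z Y n].

Definition subspace_chain C := subspace_family C /\ total_on C subset.

Definition goes_from_to C V W := family_inf C = V /\ family_sup C = W.

End Families.

Section LieNotions.
Context {R : realType} {L : banachLieType R}.
Implicit Types (A I J M : set L).

Definition lie_subalgebra A :=
  is_subspace A /\ forall a b, A a -> A b -> A (bracket a b).

Definition lie_ideal M J :=
  [/\ is_subspace J, J `<=` M & forall a x, M a -> J x -> J (bracket a x)].

Definition lie_subideal2 I :=
  lie_subalgebra I /\ exists2 J, lie_ideal [set: L] J & lie_ideal J I.

Definition closed_lie_subalgebras : set (set L) :=
  [set A | closed A /\ lie_subalgebra A].

Definition closed_lie_subideals2 : set (set L) :=
  [set I | closed I /\ lie_subideal2 I].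

(* Meant for closed subalgebras M of L, regarded as Banach Lie algebras: subsets
   of M are represented as subsets of L, and being closed in M or in L is then
   the same.  The intersection with M only matters if there is no such J. *)
Definition frattini_step M : set L :=
  M `&` \bigcap_(J in [set J | [/\ lie_ideal M J, closed J, J <> M
                                 & exists n, quotient_dim M J n]]) J.

(* Ordinals are represented as elements of well-ordered types.  The three clauses
   are the zero, successor and limit steps of the transfinite recursion. *)
Definition frattini_sequence (O : Type) (le : rel O) (P : O -> set L) :=
  let lt b a := le b a /\ b <> a in
  let is_succ b a := lt b a /\ forall c, ~ (lt b c /\ lt c a) in
  [/\ forall a, (forall b, ~ lt b a) -> P a = [set: L],
      forall a b, is_succ b a -> P a = frattini_step (P b)
    & forall a, (exists b, lt b a) -> (forall b, ~ is_succ b a) ->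
        P a = \bigcap_(b in [set b | lt b a]) P b].

(* The stable value of the transfinite chain: the value at any stage a where the
   next step does not change it. *)
Definition frattini_radical : set L :=
  [set x | exists (O : Type) (le : rel O) (P : O -> set L) (a : O),
    [/\ wochoice.well_order le, frattini_sequence le P,
        frattini_step (P a) = P a & P a x]].

Definition frattini_semisimple := frattini_radical = [set 0].

End LieNotions.

Arguments closed_lie_subalgebras {R} L.
Arguments closed_lie_subideals2 {R} L.
Arguments frattini_radical {R} L.
Arguments frattini_semisimple {R} L.

(* Main.v *)
Require Import Defs.
From HB Require Import structures.
From mathcomp Require Import all_boot all_order all_algebra complex.
From mathcomp Require Import all_classical all_reals all_analysis.
From mathcomp Require Import ring lra zify.

Set Implicit Arguments.
Unset Strict Implicit.
Unset Printing Implicit Defensive.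
Import Order.TTheory GRing.Theory Num.Theory.
Import numFieldNormedType.Exports.

Local Open Scope classical_set_scope.
Local Open Scope ring_scope.

(* Let [L] have a proper closed subalgebra of finite codimension; the point is
   that it then has a proper closed ideal of finite codimension.  Take [L0] of
   minimal codimension, hence maximal, and let F 0 = L, F 1 = L0,
   F (n+1) = {z in F n | [L, z] in F n}.  The F n are closed of finite codimension,
   and F n is an ideal as soon as F n = F (n+1), n > 0.  The graded dual of the
   filtration is a finitely generated module over the symmetric algebra of [L/L0],
   so the filtration is stationary if every symbol acts nilpotently.  If all
   [ad x], [x] in [L0], are nilpotent on [L/L0], Engel's theorem gives [v] outside
   [L0] normalizing [L0], so [L0] is an ideal by maximality.  Otherwise some [ad x]
   has a nonzero eigenvalue [lam] on [L/L0], and [lam] has a generalized eigenvector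
   [e] outside [L0] modulo F m for [m] as large as needed.  As the eigenvalues of
   [ad x] on all the L / F n are bounded by the norm of [ad x] and [ad e] shifts
   them by [lam], some power of [ad e] maps [L] deep into the filtration.  Deriving
   that power shows that [f, e] has a nilpotent symbol for all [f], so the elements
   with nilpotent symbol are normalized by [L0] and [e]; they form a subalgebra
   containing [L0] and [e], which is [L] by maximality.

   For the theorem, a stable Frattini stage M <> 0 would inherit from a gap family a
   proper closed subalgebra of finite codimension.  Conversely, if [L] is
   F-semisimple and Z <> 0, let W be the least Frattini stage containing [Z]: some
   closed ideal J of finite codimension in W does not contain [Z], and the
   intersection of Z and J is the required lower neighbour of [Z]. *)

(** * Equations in abelian groups *)

Section AbelianReflection.
Context {V : zmodType}.

Inductive zexpr := ZVar of nat | ZAdd of zexpr & zexpr | ZOpp of zexpr | ZZero.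

Fixpoint zeval (env : seq V) e : V :=
  match e with
  | ZVar i => env`_i
  | ZAdd e1 e2 => zeval env e1 + zeval env e2
  | ZOpp e1 => - zeval env e1
  | ZZero => 0
  end.

Fixpoint zcoef e (i : nat) : int :=
  match e with
  | ZVar j => (i == j)%:Z
  | ZAdd e1 e2 => zcoef e1 i + zcoef e2 i
  | ZOpp e1 => - zcoef e1 i
  | ZZero => 0
  end.

Lemma zeval_sum env e :
  zeval env e = \sum_(i <- iota 0 (size env)) env`_i *~ zcoef e i.
Proof.
elim: e => [j|e1 IH1 e2 IH2|e1 IH|] /=.
- have [js|js] := ltnP j (size env).
    rewrite (bigD1_seq j) ?iota_uniq ?mem_iota//= eqxx big1 ?addr0 ?mulr1z//.
    by move=> i /negPf ->; rewrite mulr0z.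
  rewrite nth_default// big1_seq// => i; rewrite mem_iota => /andP[_ /andP[_ ij]].
  by rewrite (_ : (i == j) = false) ?mulr0z//; lia.
- by rewrite IH1 IH2 -big_split /=; apply: eq_bigr => i _; rewrite mulrzDr.
- by rewrite IH -sumrN; apply: eq_bigr => i _; rewrite mulrNz.
- by rewrite big1// => i _; rewrite mulr0z.
Qed.

(** For a reified term the coefficients are numerals, so computation decides the premise. *)
Lemma zeval0 env e :
  all (fun i => zcoef e i == 0) (iota 0 (size env)) -> zeval env e = 0.
Proof.
move=> /allP c0; rewrite zeval_sum big1_seq// => i /c0 /eqP ->.
by rewrite mulr0z.
Qed.

End AbelianReflection.

Ltac zindex x env :=
  match env with
  | ?y :: _ => let _ := match goal with _ => unify x y end in constr:(0%N)
  | _ :: ?env' => let i := zindex x env' in constr:(i.+1)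
  end.

Ltac zinsert x env :=
  match env with
  | _ => let i := zindex x env in env
  | _ => constr:(x :: env)
  end.

Ltac zvars t env :=
  lazymatch t with
  | (?a + ?b)%R => let env' := zvars a env in zvars b env'
  | (- ?a)%R => zvars a env
  | 0%R => env
  | ?x => zinsert x env
  end.

Ltac zquote t env :=
  lazymatch t with
  | (?a + ?b)%R =>
      let a' := zquote a env in let b' := zquote b env in constr:(ZAdd a' b')
  | (- ?a)%R => let a' := zquote a env in constr:(ZOpp a')
  | 0%R => constr:(ZZero)
  | ?x => let i := zindex x env in constr:(ZVar i)
  end.

(* Decides equations of abelian groups; unlike [ring], it applies to modules. *)
Ltac abel :=
  apply/eqP; rewrite -subr_eq0; apply/eqP;
  lazymatch goal with
  | |- @eq ?V ?t _ =>
      let env := zvars t (@nil V) in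
      let e := zquote t env in
      exact: (@zeval0 _ env e isT)
  end.

(** * Quotients of finite dimension *)

Section LinearAlgebra.
Context {K : numFieldType} {X : normedModType K}.
Implicit Types (Y Z S : set X).

Lemma is_subspaceP Y :
  is_subspace Y <-> Y 0 /\ forall a u v, Y u -> Y v -> Y (a *: u + v).
Proof.
split=> [[Y0 Ylin]|[Y0 Ylin]].
  split=> [|a u v Yu Yv]; first exact/set_mem.
  by apply/set_mem; apply: Ylin; exact/mem_set.
split; first exact/mem_set.
by move=> a u v /set_mem Yu /set_mem Yv; apply/mem_set; exact: Ylin.
Qed.

Lemma subspace0 Y : is_subspace Y -> Y 0.
Proof. by case/is_subspaceP. Qed.

Lemma subspaceD Y u v : is_subspace Y -> Y u -> Y v -> Y (u + v).
Proof. by case/is_subspaceP=> _ Ylin Yu Yv; rewrite -[u]scale1r; exact: Ylin. Qed.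

Lemma subspaceZ Y a u : is_subspace Y -> Y u -> Y (a *: u).
Proof.
by case/is_subspaceP=> Y0 Ylin Yu; rewrite -[_ *: _]addr0; exact: Ylin.
Qed.

Lemma subspaceN Y u : is_subspace Y -> Y u -> Y (- u).
Proof. by move=> sY Yu; rewrite -scaleN1r; exact: subspaceZ. Qed.

Lemma subspaceB Y u v : is_subspace Y -> Y u -> Y v -> Y (u - v).
Proof. by move=> sY Yu Yv; apply: subspaceD => //; exact: subspaceN. Qed.

Lemma subspaceDr Y u v : is_subspace Y -> Y u -> Y (u + v) -> Y v.
Proof.
by move=> sY Yu Yuv; rewrite -(addKr u v) addrC; exact: subspaceB.
Qed.

Lemma subspaceDl Y u v : is_subspace Y -> Y v -> Y (u + v) -> Y u.
Proof. by rewrite addrC; exact: subspaceDr. Qed.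

Lemma subspaceZV Y a u : is_subspace Y -> a != 0 -> Y (a *: u) -> Y u.
Proof.
move=> sY a0 Yau; rewrite -[u]scale1r -(mulVf a0) -scalerA.
exact: subspaceZ.
Qed.

Lemma subspace_sum Y (I : Type) (r : seq I) (P : pred I) (v : I -> X) :
  is_subspace Y -> (forall i, P i -> Y (v i)) -> Y (\sum_(i <- r | P i) v i).
Proof.
by move=> sY Yv; apply: (big_ind Y);
  [exact: subspace0|move=> u w; exact: subspaceD|].
Qed.

Lemma subspaceT : is_subspace [set: X].
Proof. by apply/is_subspaceP. Qed.

Lemma subspace_bigcap (G : set (set X)) :
  (forall Y, G Y -> is_subspace Y) -> is_subspace (\bigcap_(Y in G) Y).
Proof.
move=> sG; apply/is_subspaceP; split=> [Y /sG/subspace0//|a u v hu hv Y GY].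
by apply: subspaceD; [exact: sG|apply: subspaceZ; [exact: sG|exact: hu]|exact: hv].
Qed.

Lemma subspaceI Y Z : is_subspace Y -> is_subspace Z -> is_subspace (Y `&` Z).
Proof.
move=> sY sZ; apply/is_subspaceP; split=> [|a u v [? ?] [? ?]].
  by split; exact: subspace0.
by split; apply: subspaceD => //; exact: subspaceZ.
Qed.

Definition independent_mod Y n (e : 'I_n -> X) :=
  forall c : 'I_n -> K, Y (\sum_i c i *: e i) -> forall i, c i = 0.

(** Coordinates on the quotient, linear only on [Z], where [Y] may stick out of [Z]. Unlike bases,
    such maps restrict, pull back and concatenate directly. *)
Definition finite_codim Z Y := exists (n : nat) (phi : X -> 'rV[K]_n),
  (forall a u v, Z u -> Z v -> phi (a *: u + v) = a *: phi u + phi v) /\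
  forall z, Z z -> (phi z = 0 <-> Y z).

(** The images of an independent family are the rows of a matrix with trivial left kernel, so there
    are at most [n] of them. *)
Lemma independent_bound Z Y n (phi : X -> 'rV[K]_n) m (e : 'I_m -> X) :
  is_subspace Z ->
  (forall a u v, Z u -> Z v -> phi (a *: u + v) = a *: phi u + phi v) ->
  (forall z, Z z -> (phi z = 0 <-> Y z)) ->
  (forall i, Z (e i)) -> independent_mod Y e -> (m <= n)%N.
Proof.
move=> sZ lphi kphi Ze ie.
have phi0 : phi 0 = 0.
  have := lphi (-1) 0 0 (subspace0 sZ) (subspace0 sZ).
  by rewrite scaler0 addr0 scaleN1r addNr.
have phi_sum (c : 'I_m -> K) (r : seq 'I_m) :
    phi (\sum_(i <- r) c i *: e i) = \sum_(i <- r) c i *: phi (e i).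
  elim: r => [|i r IH]; first by rewrite !big_nil.
  rewrite !big_cons lphi ?IH//.
  by apply: subspace_sum => // j _; exact: subspaceZ.
pose A := \matrix_(i < m) phi (e i).
suff /eqP <- : row_free A by exact: rank_leq_col.
rewrite -kermx_eq0; apply/eqP/row_matrixP => i; rewrite row0.
set w := row i (kermx A).
have : w *m A = 0 by rewrite /w -row_mul mulmx_ker row0.
rewrite mulmx_sum_row => wA.
apply/rowP => j; rewrite [RHS]mxE.
apply: (ie (fun j => w 0 j)).
apply/kphi; first by apply: subspace_sum => // k _; exact: subspaceZ.
rewrite phi_sum -[RHS]wA; apply: eq_bigr => k _; by rewrite rowK.
Qed.

(** Coordinates chosen modulo [Y] are unique by independence, and uniqueness makes the chosen map
    linear. *)
Lemma quotient_coordinates Z Y n :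
  is_subspace Z -> is_subspace Y -> quotient_dim Z Y n ->
  exists phi : X -> 'rV[K]_n,
    (forall a u v, Z u -> Z v -> phi (a *: u + v) = a *: phi u + phi v) /\
    forall z, Z z -> (phi z = 0 <-> Y z).
Proof.
move=> sZ sY [e [Ze ie ge]].
have [phi hphi] : exists phi : X -> 'rV[K]_n,
    forall z, Z z -> Y (z - \sum_i phi z 0 i *: e i).
  have /choice[phi hphi] : forall z, exists c : 'rV[K]_n,
      Z z -> Y (z - \sum_i c 0 i *: e i).
    move=> z; have [Zz|nZz] := pselect (Z z); last by exists 0.
    have [c hc] := ge z Zz; exists (\row_i c i) => _.
    by under eq_bigr do rewrite mxE.
  by exists phi.
have huniq z (c : 'rV[K]_n) : Z z -> Y (z - \sum_i c 0 i *: e i) -> phi z = c.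
  move=> Zz hc; apply/rowP => i; apply/eqP; rewrite -subr_eq0; apply/eqP.
  apply: (ie (fun i => phi z 0 i - c 0 i)).
  under eq_bigr do rewrite scalerBl.
  rewrite sumrB.
  have -> : \sum_i phi z 0 i *: e i - \sum_i c 0 i *: e i =
    (z - \sum_i c 0 i *: e i) - (z - \sum_i phi z 0 i *: e i).
    by rewrite opprB [RHS]addrC addrA subrK.
  by apply: subspaceB => //; exact: hphi.
exists phi; split=> [a u v Zu Zv|z Zz].
  apply: huniq; first by apply: subspaceD => //; exact: subspaceZ.
  under eq_bigr do rewrite !mxE scalerDl -scalerA.
  rewrite big_split /= -scaler_sumr opprD addrACA -scalerBr.
  by apply: subspaceD => //; [apply: subspaceZ => //|]; exact: hphi.
split=> [phiz|Yz].
  have := hphi z Zz; rewrite phiz big1 ?subr0// => i _.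
  by rewrite mxE scale0r.
by apply: huniq => //; rewrite big1 ?subr0// => i _; rewrite mxE scale0r.
Qed.


Lemma quotient_dim_finite_codim Z Y n :
  is_subspace Z -> is_subspace Y -> quotient_dim Z Y n -> finite_codim Z Y.
Proof. by move=> sZ sY /(quotient_coordinates sZ sY)[phi ?]; exists n, phi. Qed.

Definition extend_family n (e : 'I_n -> X) (z : X) (i : 'I_n.+1) : X :=
  oapp e z (unlift ord_max i).

Lemma sum_extend_family n (e : 'I_n -> X) z (c : 'I_n.+1 -> K) :
  \sum_i c i *: extend_family e z i =
  \sum_i c (widen_ord (leqnSn n) i) *: e i + c ord_max *: z.
Proof.
rewrite big_ord_recr /= /extend_family unlift_none; congr (_ + _).
apply: eq_bigr => i _.
have -> : widen_ord (leqnSn n) i = lift ord_max i.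
  by apply: val_inj; rewrite /= /bump leqNgt ltn_ord add0n.
by rewrite liftK.
Qed.

Lemma independent_extend Y n (e : 'I_n -> X) z : is_subspace Y ->
  independent_mod Y e -> (forall c : 'I_n -> K, ~ Y (z - \sum_i c i *: e i)) ->
  independent_mod Y (extend_family e z).
Proof.
move=> sY ie hz c; rewrite sum_extend_family => hc.
have c0 : c ord_max = 0.
  apply: contrapT => /eqP c0.
  apply: (hz (fun i => - (c ord_max)^-1 * c (widen_ord (leqnSn n) i))).
  apply: (subspaceZV sY c0).
  rewrite scalerBr scaler_sumr.
  under eq_bigr do rewrite scalerA mulNr mulrN mulrA mulfV// mul1r scaleNr.
  by rewrite sumrN opprK addrC.
rewrite c0 scale0r addr0 in hc => i.
case: (unliftP ord_max i) => [j ->|->//].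
have <- : widen_ord (leqnSn n) j = lift ord_max j.
  by apply: val_inj; rewrite /= /bump leqNgt ltn_ord add0n.
exact: (ie (fun i => c (widen_ord (leqnSn n) i))).
Qed.

Lemma extend_family_in Z n (e : 'I_n -> X) z :
  (forall i, Z (e i)) -> Z z -> forall i, Z (extend_family e z i).
Proof.
move=> Ze Zz i; rewrite /extend_family.
by case: (unliftP ord_max i) => [j _|_] /=.
Qed.

(** An independent family of maximal length spans, since otherwise one more vector could be
    appended. *)
Lemma quotient_dim_exists Z Y N : is_subspace Y ->
  (forall m (e : 'I_m -> X), (forall i, Z (e i)) -> independent_mod Y e ->
     (m <= N)%N) ->
  exists n, quotient_dim Z Y n.
Proof.
move=> sY bnd.
pose P n := `[< exists e : 'I_n -> X, (forall i, Z (e i)) /\ independent_mod Y e >].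
have P0 : exists n, P n.
  exists 0%N; apply/asboolP; exists (fun=> 0).
  by split=> [[]|c _ []].
have Pb n : P n -> (n <= N)%N by case/asboolP=> e [Ze ie]; exact: (bnd n e).
case: (ex_maxnP P0 Pb) => n /asboolP[e [Ze ie]] maxn.
exists n, e; split=> // z Zz; apply: contrapT => hz.
suff /maxn : P n.+1 by rewrite ltnn.
apply/asboolP; exists (extend_family e z); split.
  exact: extend_family_in.
apply: independent_extend => // c hc; apply: hz; by exists c.
Qed.

Lemma finite_codim_quotient_dim Z Y : is_subspace Z -> is_subspace Y ->
  finite_codim Z Y -> exists n, quotient_dim Z Y n.
Proof.
move=> sZ sY [N [phi [lphi kphi]]].
by apply: (@quotient_dim_exists _ _ N) => // m e; exact: (independent_bound sZ lphi kphi).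
Qed.

Lemma independent_mod_sub Y S n (e : 'I_n -> X) : Y `<=` S ->
  independent_mod S e -> independent_mod Y e.
Proof. by move=> YS ie c hc; apply: ie; exact: YS. Qed.

Lemma finite_codim_super Z Y S : is_subspace Z -> is_subspace S ->
  Y `<=` S -> finite_codim Z Y -> finite_codim Z S.
Proof.
move=> sZ sS YS [N [phi [lphi kphi]]].
have [|n] := @quotient_dim_exists Z S N sS.
  move=> m e Ze ie; apply: (independent_bound sZ lphi kphi Ze).
  exact: independent_mod_sub ie.
exact: quotient_dim_finite_codim.
Qed.

(** A basis of Z / S stays independent modulo [Y] after a vector of [S] outside [Y] is appended,
    because that vector vanishes modulo [S]. *)
Lemma quotient_dim_lt Z Y S m n : is_subspace Z -> is_subspace Y ->
  is_subspace S -> Y `<=` S -> S `<=` Z -> S <> Y ->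
  quotient_dim Z S m -> quotient_dim Z Y n -> (m < n)%N.
Proof.
move=> sZ sY sS YS SZ SY [e [Ze ie _]] [f [Zf if' gf]].
have [s Ss nYs] : exists2 s, S s & ~ Y s.
  apply: contrapT => h; apply: SY; apply/seteqP; split=> // s Ss.
  by apply: contrapT => nYs; apply: h; exists s.
have ie' : independent_mod Y (extend_family e s).
  apply: independent_extend => //; first exact: independent_mod_sub ie.
  move=> c hc; apply: nYs.
  have c0 i : c i = 0.
    apply: ie; rewrite -[X in S X]opprK; apply: subspaceN => //.
    exact: (subspaceDr sS Ss (YS _ hc)).
  by move: hc; rewrite big1 ?subr0// => i _; rewrite c0 scale0r.
have Ze' := extend_family_in Ze (SZ _ Ss).
have [psi hpsi] : exists psi : X -> 'rV[K]_n,
    (forall a u v, Z u -> Z v -> psi (a *: u + v) = a *: psi u + psi v) /\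
    (forall z, Z z -> (psi z = 0 <-> Y z)).
  by apply: quotient_coordinates => //; exists f.
exact: (independent_bound sZ hpsi.1 hpsi.2 Ze' ie').
Qed.

Lemma quotient_dim_gt0 Z Y n : is_subspace Y -> ~ (Z `<=` Y) ->
  quotient_dim Z Y n -> (0 < n)%N.
Proof.
case: n => // sY ZY [e [_ _ ge]]; case: ZY => z /ge[c].
by rewrite big_ord0 subr0.
Qed.

Lemma finite_codim_sub Z Z' Y : Z' `<=` Z -> finite_codim Z Y ->
  finite_codim Z' Y.
Proof.
move=> ZZ' [n [phi [lphi kphi]]]; exists n, phi; split=> [a u v Zu Zv|z Zz].
  by apply: lphi; exact: ZZ'.
by apply: kphi; exact: ZZ'.
Qed.

Lemma finite_codimI Z Y Y' : finite_codim Z Y -> finite_codim Z Y' ->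
  finite_codim Z (Y `&` Y').
Proof.
move=> [n [phi [lphi kphi]]] [m [psi [lpsi kpsi]]].
exists (n + m)%N, (fun z => row_mx (phi z) (psi z)); split=> [a u v Zu Zv|z Zz].
  by rewrite lphi// lpsi// scale_row_mx add_row_mx.
rewrite -row_mx0; split=> [/eq_row_mx[/kphi ? /kpsi ?]|[/kphi-> // /kpsi->//]].
by split; auto.
Qed.

Lemma finite_codim_self Z : finite_codim Z Z.
Proof. by exists 0%N, (fun=> 0); split=> [a u v _ _|z Zz]; rewrite ?scaler0 ?addr0. Qed.

Lemma finite_codim_bigcap Z (I : eqType) (r : seq I) (Y : I -> set X) :
  (forall i, finite_codim Z (Y i)) ->
  finite_codim Z [set y | Z y /\ forall i, i \in r -> Y i y].
Proof.
move=> fY; elim: r => [|i r IH].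
  by have := finite_codim_self Z; congr finite_codim; apply/seteqP; split=> [z|z []].
have := finite_codimI (fY i) IH; congr finite_codim; apply/seteqP; split=> z /=.
  by move=> [Yi [Zz Yr]]; split=> // j; rewrite inE => /predU1P[->//|]; exact: Yr.
move=> [Zz Yr]; split; first by apply: Yr; rewrite mem_head.
by split=> // j jr; apply: Yr; rewrite inE jr orbT.
Qed.

Lemma finite_codim_preimage Z Z' Y (T : X -> X) : linear T ->
  (forall z, Z z -> Z' (T z)) -> finite_codim Z' Y ->
  finite_codim Z [set z | Y (T z)].
Proof.
move=> lT TZ [n [phi [lphi kphi]]]; exists n, (phi \o T); split=> [a u v Zu Zv|z Zz] /=.
  by rewrite lT lphi//; exact: TZ.
by apply: kphi; exact: TZ.
Qed.

Definition adjoin Y (y : X) : set X := [set w | exists l k, Y l /\ w = l + k *: y].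

Lemma adjoin_subspace Y y : is_subspace Y -> is_subspace (adjoin Y y).
Proof.
move=> sY; apply/is_subspaceP; split.
  by exists 0, 0; split; [exact: subspace0|rewrite scale0r addr0].
move=> a _ _ [l [k [Hl ->]]] [l' [k' [Hl' ->]]].
exists (a *: l + l'), (a * k + k'); split.
  by apply: subspaceD => //; exact: subspaceZ.
by rewrite scalerDr scalerDl scalerA addrACA.
Qed.

Lemma sub_adjoin Y y : Y `<=` adjoin Y y.
Proof. by move=> l Hl; exists l, 0; rewrite scale0r addr0. Qed.

Lemma adjoin_mem Y y : is_subspace Y -> adjoin Y y y.
Proof.
by move=> sY; exists 0, 1; split; [exact: subspace0|rewrite scale1r add0r].
Qed.

End LinearAlgebra.

(** * The filtration defined by a subalgebra *)

Record is_lie_bracket (K : numFieldType) (X : normedModType K)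
    (br : X -> X -> X) : Prop := {
  br_linearl : forall b, linear (br^~ b);
  br_linearr : forall a, linear (br a);
  brxx : forall a, br a a = 0;
  br_jacobi : forall a b c, br a (br b c) + br b (br c a) + br c (br a b) = 0
}.

Section Filtration.
Context {K : numFieldType} {X : normedModType K} (br : X -> X -> X).
Hypothesis lie : is_lie_bracket br.
Implicit Types (a b c u v w x y z : X) (k : K) (s t : seq X) (S T : X -> X).

Lemma brDl a b c : br (a + b) c = br a c + br b c.
Proof. by have := br_linearl lie c 1 a b; rewrite /= !scale1r. Qed.

Lemma brDr a b c : br a (b + c) = br a b + br a c.
Proof. by have := br_linearr lie a 1 b c; rewrite /= !scale1r. Qed.

Lemma br0l a : br 0 a = 0.
Proof. by apply: (addIr (br 0 a)); rewrite -brDl !add0r. Qed.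

Lemma br0r a : br a 0 = 0.
Proof. by apply: (addIr (br a 0)); rewrite -brDr !add0r. Qed.

Lemma brZl k a b : br (k *: a) b = k *: br a b.
Proof. by have := br_linearl lie b k a 0; rewrite /= br0l !addr0. Qed.

Lemma brZr k a b : br a (k *: b) = k *: br a b.
Proof. by have := br_linearr lie a k b 0; rewrite /= br0r !addr0. Qed.

Lemma brNl a b : br (- a) b = - br a b.
Proof. by rewrite -scaleN1r brZl scaleN1r. Qed.

Lemma brNr a b : br a (- b) = - br a b.
Proof. by rewrite -scaleN1r brZr scaleN1r. Qed.

Lemma brBl a b c : br (a - b) c = br a c - br b c.
Proof. by rewrite brDl brNl. Qed.

Lemma brBr a b c : br a (b - c) = br a b - br a c.
Proof. by rewrite brDr brNr. Qed.

Lemma br_anti a b : br a b = - br b a.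
Proof.
apply/eqP; rewrite -addr_eq0; apply/eqP.
have := brxx lie (a + b).
by rewrite brDl !brDr !(brxx lie) add0r addr0.
Qed.

Lemma br_derivation a b c : br a (br b c) = br (br a b) c + br b (br a c).
Proof.
apply/eqP; rewrite -subr_eq0; apply/eqP.
rewrite -[RHS](br_jacobi lie a b c).
by rewrite opprD addrA addrAC -brNr -(br_anti c a) -(br_anti c (br a b)).
Qed.

Lemma br_sumr (I : Type) (r : seq I) (P : pred I) (F : I -> X) a :
  br a (\sum_(i <- r | P i) F i) = \sum_(i <- r | P i) br a (F i).
Proof. by apply: (big_morph (br a)); [exact: brDr|exact: br0r]. Qed.

(* The operators given by the degree-[m] part of the enveloping algebra. *)
Inductive ord : nat -> (X -> X) -> Prop :=
| ord_id m : ord m idfun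
| ord_zero m : ord m (fun=> 0)
| ord_ad m y T : ord m T -> ord m.+1 (fun z => br y (T z))
| ord_lin m k S T : ord m S -> ord m T -> ord m (fun z => k *: S z + T z).

Lemma ord_ext m S T : S =1 T -> ord m S -> ord m T.
Proof. by move=> /funext ->. Qed.

Lemma ordD m S T : ord m S -> ord m T -> ord m (fun z => S z + T z).
Proof.
by move=> oS oT; apply: ord_ext (ord_lin 1 oS oT) => z; rewrite scale1r.
Qed.

Lemma ordZ m k S : ord m S -> ord m (fun z => k *: S z).
Proof.
by move=> oS; apply: ord_ext (ord_lin k oS (ord_zero m)) => z; rewrite addr0.
Qed.

Lemma ordS m T : ord m T -> ord m.+1 T.
Proof.
by elim=> {m T} [m|m|m y T _ IH|m k S T _ IHS _ IHT];
  [exact: ord_id|exact: ord_zero|exact: ord_ad|exact: ord_lin].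
Qed.

Lemma ordW m n T : (m <= n)%N -> ord m T -> ord n T.
Proof.
move=> /subnK <- oT; elim: (n - m)%N => // d; rewrite addSn; exact: ordS.
Qed.

Lemma ord_linear m T : ord m T -> linear T.
Proof.
elim=> {m T} [m|m|m y T _ IH|m k S T _ IHS _ IHT] a u v //.
- by rewrite scaler0 addr0.
- by rewrite IH brDr brZr.
- by rewrite IHS IHT !scalerDr addrACA !scalerA mulrC.
Qed.

Lemma ord_comp m n S T : ord m S -> ord n T -> ord (m + n) (fun z => S (T z)).
Proof.
move=> oS oT; elim: oS => {m S} [m|m|m y S _ IH|m k S S' _ IHS _ IHS'].
- by apply: ordW oT; rewrite leq_addl.
- exact: ord_zero.
- by rewrite addSn; exact: ord_ad.
- exact: ord_lin.
Qed.

Lemma ord_ad1 y : ord 1 (br y).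
Proof. exact: (ord_ad y (ord_id 0)). Qed.

(** The commutator of [ad y] and [ad u] is [ad (br y u)], so commuting with [ad y] replaces letters
    and adds none. *)
Lemma ord_commutator y m T : ord m T -> ord m (fun z => br y (T z) - T (br y z)).
Proof.
elim=> {m T} [m|m|m u T oT IH|m k S T oS IHS oT IHT].
- by apply: ord_ext (ord_zero m) => z; rewrite subrr.
- by apply: ord_ext (ord_zero m) => z; rewrite br0r subrr.
- apply: ord_ext (ordD (ord_ad (br y u) oT) (ord_ad u IH)) => z.
  by rewrite brBr addrA -br_derivation.
- apply: ord_ext (ord_lin k IHS IHT) => z.
  by rewrite brDr brZr opprD addrACA scalerBr.
Qed.

Definition word s : X -> X := foldr (fun u T => br u \o T) idfun s.

Lemma word_cat s t z : word (s ++ t) z = word s (word t z).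
Proof. by elim: s => //= u s ->. Qed.

Lemma ord_word s : ord (size s) (word s).
Proof. by elim: s => [|u s IH]; [exact: ord_id|exact: ord_ad]. Qed.

(** Moving a letter across [T] costs a commutator, which has one degree less than the product. This
    is commutativity of the associated graded algebra. *)
Lemma ord_word_commutator s m T : ord m T ->
  ord (size s + m).-1 (fun z => word s (T z) - T (word s z)).
Proof.
elim: s m T => [|u s IH] m T oT.
  by apply: ord_ext (ord_zero _) => z; rewrite subrr.
case: s IH => [|v s] IH; first by rewrite /=; exact: ord_commutator.
have := ord_comp (ord_commutator u oT) (ord_word (v :: s)).
have /(ord_ad u) := IH _ _ oT; rewrite /= [(m + _)%N]addnC addSn /= => o1 o2.
apply: ord_ext (ordD o1 o2) => z /=.
by rewrite brBr addrA subrK.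
Qed.

Context (L0 : set X).
Hypothesis sL0 : is_subspace L0.
Hypothesis aL0 : forall a b, L0 a -> L0 b -> L0 (br a b).

(* Indexed so that [fil 1 = L0]. *)
Fixpoint fil (n : nat) : set X :=
  if n is n'.+1 then [set z | [/\ L0 z, fil n' z & forall y, fil n' (br y z)]]
  else [set: X].

Lemma filSP n z :
  fil n.+1 z <-> [/\ L0 z, fil n z & forall y, fil n (br y z)].
Proof. by []. Qed.

Lemma fil_subspace n : is_subspace (fil n).
Proof.
elim: n => [|n IH]; first exact: subspaceT.
apply/is_subspaceP; split=> [|a u v /filSP[u1 u2 u3] /filSP[v1 v2 v3]].
  by apply/filSP; split=> [||y]; rewrite ?br0r; exact: subspace0.
apply/filSP; split=> [||y]; [| |rewrite brDr brZr]; apply: subspaceD => //;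
  by apply: subspaceZ.
Qed.

Lemma filS n : fil n.+1 `<=` fil n.
Proof. by move=> z []. Qed.

Lemma fil_le m n : (m <= n)%N -> fil n `<=` fil m.
Proof.
move=> /subnK <-; elim: (n - m)%N => // d IH; rewrite addSn.
by apply: subset_trans IH; exact: filS.
Qed.

Lemma fil_L0 n : fil n.+1 `<=` L0.
Proof. by move=> z []. Qed.

Lemma fil1 : fil 1 = L0.
Proof. by apply/seteqP; split=> [z []|z L0z]. Qed.

Lemma fil_br n y z : fil n.+1 z -> fil n (br y z).
Proof. by case/filSP. Qed.

Lemma fil_brl n y z : fil n.+1 z -> fil n (br z y).
Proof.
by move=> hz; rewrite br_anti; apply: subspaceN; [exact: fil_subspace|exact: fil_br].
Qed.

Lemma fil_L0_br n l z : L0 l -> fil n z -> fil n (br l z).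
Proof.
move=> L0l; elim: n z => // n IH z /filSP[z1 z2 z3]; apply/filSP.
split; [exact: aL0|exact: IH|move=> y].
rewrite br_derivation; apply: subspaceD; first exact: fil_subspace.
  exact: z3.
by apply: IH.
Qed.

(** [L0] preserves each stage, so the condition on [br y z] need only be tested for finitely many
    [y], a basis modulo [L0]. *)
Lemma fil_finite_codim n : finite_codim [set: X] L0 ->
  finite_codim [set: X] (fil n).
Proof.
move=> fL0; elim: n => [|n IH]; first exact: finite_codim_self.
case: n IH => [|n] IH; first by rewrite fil1.
have [d [e [_ _ ge]]] := finite_codim_quotient_dim subspaceT sL0 fL0.
pose Y i := [set z | fil n.+1 (br (e i) z)].
have fY i : finite_codim [set: X] (Y i).
  by apply: (@finite_codim_preimage _ _ _ [set: X]) => //; exact: br_linearr.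
have := finite_codimI IH (finite_codim_bigcap (enum 'I_d) fY).
apply: finite_codim_super; [exact: subspaceT|exact: fil_subspace|].
move=> z [/[dup] zn [L0z _ _] [_ zY]]; split=> // y.
have [c hc] := ge y I.
rewrite -(subrK (\sum_i c i *: e i) y) brDl; apply: subspaceD.
- exact: fil_subspace.
- exact: fil_L0_br.
- rewrite br_anti br_sumr; apply: subspaceN; first exact: fil_subspace.
  apply: subspace_sum => [|i _]; first exact: fil_subspace.
  rewrite brZr; apply: subspaceZ; first exact: fil_subspace.
  rewrite br_anti; apply: subspaceN; first exact: fil_subspace.
  by apply: zY; rewrite mem_enum.
Qed.

Lemma ord_fil m T i z : ord m T -> fil (i + m) z -> fil i (T z).
Proof.
move=> oT; elim: oT i z => {m T} [m|m|m y T _ IH|m k S T _ IHS _ IHT] i z hz.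
- by move: hz; apply: fil_le; exact: leq_addr.
- by apply: subspace0; exact: fil_subspace.
- by apply: fil_br; apply: IH; rewrite addSnnS.
- apply: subspaceD; [exact: fil_subspace| |exact: IHT].
  by apply: subspaceZ; [exact: fil_subspace|exact: IHS].
Qed.

Lemma ord_fil_L0 m n T z : ord m T -> (m < n)%N -> fil n z -> L0 (T z).
Proof.
move=> oT mn hz; rewrite -fil1; apply: ord_fil oT _.
by apply: fil_le hz.
Qed.

Lemma fil_words n z : fil n.+1 z <-> forall s, (size s <= n)%N -> L0 (word s z).
Proof.
elim: n z => [|n IH] z.
  rewrite fil1; split=> [L0z [|//]//|]; exact: (fun h => h [::] isT).
split=> [zn s sn|h].
  by apply: ord_fil_L0 (ord_word s) _ zn.
split; first exact: (h [::]).
  by apply/IH => s sn; apply: h; exact: leqW.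
move=> y; apply/IH => s sn.
by rewrite -(word_cat s [:: y]); apply: h; rewrite size_cat addn1.
Qed.

(* The word [s] is read as a monomial of the symmetric algebra of [X / L0]: it is
   good when this monomial kills the generators of the graded dual of [fil].  This
   explains why the order of the letters is irrelevant and letters may be added. *)
Definition good s := forall z, fil (size s) z -> L0 (word s z).

(** Swapping two blocks changes the word by an operator of lower degree, which sends the relevant
    stage into [L0]. *)
Lemma good_catCA s1 s2 s3 : good (s1 ++ s2 ++ s3) -> good (s2 ++ s1 ++ s3).
Proof.
move=> g z; rewrite !size_cat !word_cat => hz.
have := g z; rewrite !size_cat !word_cat addnCA => /(_ hz) {}g.
(* With both blocks empty the degree cannot drop, but there is nothing to swap. *)
have [|s12] := posnP (size s1 + size s2)%N.
  move/eqP; rewrite addn_eq0 !size_eq0 => /andP[/eqP s10 /eqP s20].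
  by rewrite s10 s20 in g *.
apply: (@subspaceDr _ _ L0 (- word s1 (word s2 (word s3 z)))) => //.
  exact: subspaceN.
rewrite addrC.
apply: (@ord_fil_L0 _ (size s2 + size s1) _ _
  (ord_word_commutator s2 (ord_word s1))).
  by rewrite prednK// addnC.
by apply: ord_fil (ord_word s3) _; rewrite -addnA.
Qed.

Lemma good_perm s t : perm_eq s t -> good s -> good t.
Proof. by apply: (catCA_perm_ind (P := good)); exact: good_catCA. Qed.

Lemma good_catr s t : good s -> good (s ++ t).
Proof.
move=> g z; rewrite size_cat word_cat => hz; apply: g.
exact: ord_fil (ord_word t) hz.
Qed.

Lemma good_catl s t : good s -> good (t ++ s).
Proof.
by move=> gs; apply: good_perm (good_catr gs (t := t)); rewrite perm_catC.
Qed.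

Lemma good_L0 u s : L0 u -> good (u :: s).
Proof.
move=> L0u z hz /=; apply: aL0 => //; rewrite -fil1.
by apply: ord_fil (ord_word s) _; rewrite add1n.
Qed.

Lemma good_lin k u v s : good (u :: s) -> good (v :: s) ->
  good (k *: u + v :: s).
Proof.
move=> gu gv z hz /=; rewrite brDl brZl; apply: subspaceD => //.
  by apply: subspaceZ => //; exact: gu.
exact: gv.
Qed.

Definition uniformly_good (A : set X) m :=
  forall s, size s = m -> (forall u, u \in s -> A u) -> good s.

(** Expanding a product of sums, each monomial has at least [m] letters from [A] or at least [n]
    from [B], and the order of letters is irrelevant. *)
Lemma uniformly_goodD (A B : set X) m n :
  uniformly_good A m -> uniformly_good B n ->
  uniformly_good [set w | exists u v, [/\ A u, B v & w = u + v]] (m + n).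
Proof.
move=> gA gB.
(* [s1] and [s2] collect the letters already chosen; [s3] holds the sums still to be expanded. *)
suff H s3 s1 s2 : (forall u, u \in s1 -> A u) -> (forall u, u \in s2 -> B u) ->
    (forall w, w \in s3 -> exists u v, [/\ A u, B v & w = u + v]) ->
    (size s1 + size s2 + size s3 = m + n)%N -> good (s3 ++ s1 ++ s2).
  by move=> s ss sAB; have := H s [::] [::]; rewrite /= cats0; apply.
elim: s3 s1 s2 => [|w s3 IH] s1 s2 As1 Bs2 ABs3 sz.
  have [ms1|ms1] := leqP m (size s1).
    rewrite -(cat_take_drop m s1) -catA /=; apply: good_catr; apply: gA.
      by rewrite size_takel.
    by move=> u /mem_take; exact: As1.
  have ns2 : (n <= size s2)%N by move: sz; rewrite /=; lia.
  rewrite /= -(cat_take_drop n s2); apply: good_catl; apply: good_catr; apply: gB.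
    by rewrite size_takel.
  by move=> u /mem_take; exact: Bs2.
have [u [v [Au Bv ->]]] := ABs3 w (mem_head _ _).
have ABs3' w' : w' \in s3 -> exists u v, [/\ A u, B v & w' = u + v].
  by move=> w's3; apply: ABs3; rewrite inE w's3 orbT.
rewrite -[u]scale1r cat_cons; apply: good_lin.
  apply: good_perm (IH (u :: s1) s2 _ _ _ _) => //.
  - by apply/permP => p; rewrite /= !count_cat /= !count_cat; lia.
  - by move=> u'; rewrite inE => /predU1P[->//|]; exact: As1.
  - by move: sz => /=; lia.
apply: good_perm (IH s1 (v :: s2) _ _ _ _) => //.
- by apply/permP => p; rewrite /= !count_cat /=; lia.
- by move=> u'; rewrite inE => /predU1P[->//|]; exact: Bs2.
- by move: sz => /=; lia.
Qed.

Definition nilpotent_symbol u := exists m, good (nseq m u).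

Lemma nilpotent_symbol_line u : nilpotent_symbol u ->
  exists m, uniformly_good [set v | exists k, v = k *: u] m.
Proof.
move=> [m gm]; exists m => s ss su z; rewrite ss => hz.
have [k ->] : exists k, word s z = k *: word (nseq m u) z.
  elim: s m ss su {gm hz} => [|v s IH] m <- su; first by exists 1; rewrite scale1r.
  have [|k hk] := IH _ erefl; first by move=> w ws; apply: su; rewrite inE ws orbT.
  have [k' ->] := su v (mem_head _ _).
  by exists (k' * k); rewrite /= hk brZl brZr scalerA.
by apply: subspaceZ => //; apply: gm; rewrite size_nseq.
Qed.

Lemma nilpotent_symbol_subspace : is_subspace nilpotent_symbol.
Proof.
apply/is_subspaceP; split=> [|k u v].
  by exists 1%N; apply: good_L0; exact: subspace0.
move=> /nilpotent_symbol_line[m gu] /nilpotent_symbol_line[n gv].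
exists (m + n)%N; apply: (uniformly_goodD gu gv); first by rewrite size_nseq.
move=> w /nseqP[-> _]; exists (k *: u), v; split=> //; first by exists k.
by exists 1; rewrite scale1r.
Qed.

Lemma nilpotent_symbol_L0 : L0 `<=` nilpotent_symbol.
Proof. by move=> u L0u; exists 1%N; exact: good_L0. Qed.

(** Induction over a basis modulo [L0]: start from [L0], where one letter suffices, and add one line
    at a time. *)
Lemma uniformly_goodT : finite_codim [set: X] L0 ->
  (forall u, nilpotent_symbol u) -> exists m, uniformly_good [set: X] m.
Proof.
move=> fL0 nil.
have [d [e [_ _ ge]]] := finite_codim_quotient_dim subspaceT sL0 fL0.
suff [m hm] : exists m, uniformly_good
    [set w | exists c : 'I_d -> K, L0 (w - \sum_(i <- enum 'I_d) c i *: e i)] m.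
  exists m => s ss _; apply: hm => // u _.
  by have [c hc] := ge u I; exists c; rewrite big_enum.
elim: (enum 'I_d) => [|i r [m IH]].
  exists 1%N => -[|u [|//]]//= _ su; apply: good_L0.
  have [c] := su u (mem_head _ _); by rewrite big_nil subr0.
have [n hn] := nilpotent_symbol_line (nil (e i)).
exists (m + n)%N => s ss su; apply: (uniformly_goodD IH hn) => // w ws.
have [c hc] := su w ws; exists (w - c i *: e i), (c i *: e i).
split; last by rewrite subrK.
  by exists c; move: hc; rewrite big_cons opprD addrA.
by exists (c i).
Qed.

(** The next stage tests only the additional words of length [m + 1], and these are good because
    their first [m] letters are. *)
Lemma fil_stationary m : uniformly_good [set: X] m -> fil m.+1 `<=` fil m.+2.
Proof.
move=> gm z zm; apply/fil_words => s; rewrite leq_eqVlt => /predU1P[ss|ss].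
  have gs : good s.
    rewrite -(cat_take_drop m s); apply: good_catr; apply: gm => //.
    by rewrite size_takel ?ss.
  by apply: gs; rewrite ss.
by move/fil_words: zm; apply.
Qed.

End Filtration.

(** * Elements with nilpotent symbol *)

Section NilpotentSymbols.
Context {K : numFieldType} {X : normedModType K} (br : X -> X -> X).
Hypothesis lie : is_lie_bracket br.
Context (L0 : set X).
Hypothesis sL0 : is_subspace L0.
Hypothesis aL0 : forall a b, L0 a -> L0 b -> L0 (br a b).
Implicit Types (a b c u v w x y z e f : X) (k : K) (S T : X -> X).

Local Notation ord := (ord br).
Local Notation word := (word br).
Local Notation fil := (fil br L0).

Lemma word_nseqSr n u z : word (nseq n.+1 u) z = word (nseq n u) (br u z).
Proof. by elim: n z => //= n IH z; rewrite -IH. Qed.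

Lemma ord_linearD m T u v : ord m T -> T (u + v) = T u + T v.
Proof. by move/(ord_linear lie)/(_ 1 u v); rewrite !scale1r. Qed.

Lemma ord_linearZ m T k u : ord m T -> T (k *: u) = k *: T u.
Proof.
move=> oT; have := ord_linear lie oT k u 0; have := ord_linear lie oT (-1) 0 0.
by rewrite !addr0 scaler0 scaleN1r addNr => ->; rewrite addr0.
Qed.

Lemma ord_linear0 m T : ord m T -> T 0 = 0.
Proof. by move=> oT; have := ord_linearZ 0 0 oT; rewrite !scale0r. Qed.

Lemma ord_linearB m T u v : ord m T -> T (u - v) = T u - T v.
Proof.
move=> oT; rewrite -scaleN1r (ord_linearD _ _ oT) (ord_linearZ _ _ oT).
by rewrite scaleN1r.
Qed.

Lemma ord_nseq n u : ord n (word (nseq n u)).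
Proof. by rewrite -{1}(size_nseq n u); exact: ord_word. Qed.

(** Error of the commutative rule D(U^n) = n U^(n-1) D(U), where U is [ad u] and D is the commutator
    with [ad f]. *)
Definition power_remainder f u n z :=
  br f (word (nseq n u) z) - word (nseq n u) (br f z)
    - n%:R *: word (nseq n.-1 u) (br (br f u) z).

Lemma ord_power_remainder f u n : ord n.-1 (power_remainder f u n).
Proof.
case: n => [|n]; first by apply: ord_ext (ord_zero _ _) => z;
  rewrite /power_remainder /= subrr scale0r subr0.
elim: n => [|n IH].
  apply: ord_ext (ord_zero _ _) => z.
  rewrite /power_remainder /= scale1r.
  by rewrite (br_derivation lie f u z) addrK subrr.
have o1 := ord_commutator lie (br f u) (ord_nseq n.+1 u).
have o2 := ord_ad u IH.
apply: ord_ext (ordD o1 o2) => z.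
rewrite /power_remainder [nseq n.+2 u]/= [n.+2.-1]/= [n.+1.-1]/=.
have wS y : word (u :: nseq n.+1 u) y = br u (word (nseq n.+1 u) y) by [].
rewrite !wS (br_derivation lie f u) !(brBr lie) (brZr lie).
have -> : br u (word (nseq n u) (br (br f u) z)) = word (nseq n.+1 u) (br (br f u) z).
  by [].
rewrite [n.+2%:R]mulrSr scalerDl scale1r.
abel.
Qed.

(* In the associated graded algebra this is the classical derivation identity
   [D(A^a B^b) B - b A^a B^b C = a A^(a-1) B^(b+2)], where [B = D A], [C = D B]. *)
Lemma ord_derivation_step f e (a b : nat) :
  let e1 := br f e in let e2 := br f e1 in
  let W z := word (nseq a.+1 e) (word (nseq b e1) z) in
  ord (a.+1 + b) (fun z => br f (W (br e1 z)) - W (br f (br e1 z))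
     - b%:R *: W (br e2 z)
     - a.+1%:R *: word (nseq a e) (word (nseq b.+2 e1) z)).
Proof.
move=> e1 e2 W.
have oA := ord_nseq a.+1 e.
have o1 := ord_comp (ord_power_remainder f e a.+1) (ord_nseq b.+1 e1).
have o2 : ord (a.+1 + b)
    (fun z => word (nseq a.+1 e) (power_remainder f e1 b (br e1 z))).
  apply: (ord_comp oA); case: b {W o1} => [|b].
    apply: ord_ext (ord_zero _ _) => z.
    by rewrite /power_remainder /= subrr scale0r subr0.
  have := ord_comp (ord_power_remainder f e1 b.+1) (ord_ad1 br e1).
  by rewrite addn1.
have o3 : ord (a.+1 + b) (fun z => word (nseq a.+1 e)
    (b%:R *: (word (nseq b.-1 e1) (br e2 (br e1 z)) - word (nseq b e1) (br e2 z)))).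
  apply: (ord_comp oA); case: b {W o1 o2} => [|b].
    by apply: ord_ext (ord_zero _ _) => z; rewrite scale0r.
  apply: ordZ; have := ord_comp (ord_nseq b e1)
    (ord_commutator lie e2 (ord_ad1 br e1)).
  rewrite addn1; apply: ord_ext => z.
  by rewrite (ord_linearB _ _ (ord_nseq b e1)) word_nseqSr.
rewrite [a.+1.-1]/= addnS -addSn in o1.
apply: ord_ext (ordD (ordD o1 o2) o3) => z.
rewrite /power_remainder /W [a.+1.-1]/=.
rewrite !(ord_linearB _ _ oA, ord_linearZ _ _ oA) !scalerBr -!word_nseqSr.
rewrite -/e1 -/e2.
have -> : br e1 (word (nseq b.+1 e1) z) = word (nseq b.+2 e1) z by [].
abel.
Qed.

(* [I j m] is a class of operators of degree [m], stable under multiplication, that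
   survives [j] more derivations by [ad f]. *)
Lemma derivation_trick e f (I : nat -> nat -> (X -> X) -> Prop) N :
  (forall j m k S T, I j m S -> I j m T -> I j m (fun z => k *: S z + T z)) ->
  (forall j m y T, I j m T -> I j m.+1 (fun z => T (br y z))) ->
  (forall j m T, I j.+1 m T -> I j m T) ->
  (forall j m T, I j.+1 m T -> I j m (fun z => br f (T z) - T (br f z))) ->
  I N N (word (nseq N e)) ->
  exists2 k, k != 0 & exists T, ord (N + N).-1 T /\
    I 0%N (N + N)%N (fun z => k *: word (nseq (N + N) (br f e)) z + T z).
Proof.
move=> Ilin Iright Idecr Ider IN.
pose e1 := br f e; pose e2 := br f e1.
(* After [i] rounds, [i] factors [ad e] have been traded for twice as many factors [ad e1], at the
   cost of [i] of the [N] permitted derivations. *)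
suff H i : (i <= N)%N -> exists2 k, k != 0 & exists T, ord (N + i).-1 T /\
    I (N - i)%N (N + i)%N (fun z =>
      k *: word (nseq (N - i) e) (word (nseq (i + i) e1) z) + T z).
  by have := H N (leqnn N); rewrite subnn.
elim: i => [_|i IH iN].
  exists 1; first exact: oner_neq0.
  exists (fun=> 0); split; first exact: ord_zero.
  rewrite addn0 subn0; move: IN; congr (I _ _ _); apply/funext => z.
  by rewrite scale1r addr0.
have [k k0 [T [oT IT]]] := IH (ltnW iN).
set a := (N - i.+1)%N; have Na : (N - i)%N = a.+1 by rewrite /a; lia.
rewrite Na in IT; set b := (i + i)%N in IT *.
have abN : (a.+1 + b = N + i)%N by rewrite /a /b; lia.
pose W z := word (nseq a.+1 e) (word (nseq b e1) z).
pose V z := k *: W z + T z.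
have oW : ord (N + i) W.
  by rewrite -abN; exact: ord_comp (ord_nseq _ _) (ord_nseq _ _).
have oV : ord (N + i) V.
  by apply: ord_lin => //; apply: ordW oT; exact: leq_pred.
(* Differentiating [(ad e)^(a + 1)] brings down [a + 1], nonzero in characteristic zero. *)
exists (k * a.+1%:R); first by rewrite mulf_neq0// pnatr_eq0.
have {}oT : ord (N + i) (fun z =>
    (br f (T (br e1 z)) - T (br f (br e1 z))) + (- b%:R) *: T (br e2 z)).
  have Ni : ((N + i).-1 + 1 = N + i)%N by lia.
  apply: ordD.
    by have := ord_comp (ord_commutator lie f oT) (ord_ad1 br e1); rewrite Ni.
  by apply: ordZ; have := ord_comp oT (ord_ad1 br e2); rewrite Ni.
have := ord_derivation_step f e a b; rewrite -/e1 -/e2 abN => /(ordZ k) oR.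
have oE := ordD oT oR.
exists (fun z => k *: (br f (W (br e1 z)) - W (br f (br e1 z))
     - b%:R *: W (br e2 z) - a.+1%:R *: word (nseq a e) (word (nseq b.+2 e1) z))
   + ((br f (T (br e1 z)) - T (br f (br e1 z))) + (- b%:R) *: T (br e2 z))).
rewrite addnS; split.
  by apply: ord_ext oE => z; rewrite addrC.
(* [I1] derives and then multiplies by [ad e1]; subtracting [b] times [I2] cancels the terms in
   which the derivation hits a factor [ad e1]. *)
have I1 := Iright _ _ e1 _ (Ider _ _ _ IT).
have I2 := Iright _ _ e2 _ (Idecr _ _ _ IT).
move: (Ilin _ _ (- b%:R) _ _ I2 I1); congr (I _ _ _); apply/funext => z.
have bE : (i.+1 + i.+1 = b.+2)%N by rewrite /b; lia.
rewrite bE -/(W _) -/(W _) -/(W _) -scalerA.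
rewrite (brDr lie) (brZr lie) !scalerBr !scalerDr.
rewrite !scaleNr !opprD !scalerA [b%:R * k]mulrC.
abel.
Qed.

(** [I j m] consists of the operators sending [fil m] into [L0]. As [ad l] preserves [L0] and every
    stage, derivation by it can be repeated at will. *)
Lemma nilpotent_symbol_stable_L0 l u : L0 l -> nilpotent_symbol br L0 u ->
  nilpotent_symbol br L0 (br l u).
Proof.
move=> L0l [[|N] gN].
  by exists 0%N => z _; exact: gN.
pose I (j m : nat) T := forall z, fil m z -> L0 (T z).
have [|||||k k0 [T [oT IT]]] := @derivation_trick u l I N.+1.
- by move=> j m k S T IS IT z hz; apply: subspaceD => //;
    [apply: subspaceZ => //; exact: IS|exact: IT].
- by move=> j m y T IT z hz; apply: IT; exact: fil_br.
- by move=> j m T.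
- move=> j m T IT z hz; apply: subspaceB => //; first by apply: aL0 => //; exact: IT.
  by apply: IT; exact: (fil_L0_br lie).
- by move=> z; have := gN z; rewrite size_nseq.
exists (N.+1 + N.+1)%N => z; rewrite size_nseq => hz.
apply: (subspaceZV sL0 k0); apply: (subspaceDl sL0 _ (IT z hz)).
by apply: (ord_fil_L0 lie sL0 oT) hz; rewrite prednK.
Qed.

(** [I j m] consists of the operators with image in [fil j.+1]. Each derivation by [ad f] costs one
    stage, and the last one still leaves [fil 1 = L0]. *)
Lemma nilpotent_symbol_br e f N : (forall z, fil N.+1 (word (nseq N e) z)) ->
  nilpotent_symbol br L0 (br f e).
Proof.
case: N => [|N] hN.
  by exists 0%N => z _ /=; have := hN z; rewrite fil1.
pose I (j m : nat) T := forall z, fil j.+1 (T z).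
have sF := fil_subspace lie sL0.
have [|||||k k0 [T [oT IT]]] := @derivation_trick e f I N.+1 => //.
- move=> j m k S T IS IT z; apply: subspaceD => //.
  by apply: subspaceZ => //; exact: IS.
- by move=> j m y T IT z; exact: IT.
- by move=> j m T IT z; apply: filS; exact: IT.
- move=> j m T IT z; apply: subspaceB => //; first by apply: fil_br; exact: IT.
  by apply: filS; exact: IT.
exists (N.+1 + N.+1)%N => z; rewrite size_nseq => hz.
apply: (subspaceZV sL0 k0).
have := IT z; rewrite fil1 => ITz; apply: (subspaceDl sL0 _ ITz).
by apply: (ord_fil_L0 lie sL0 oT) hz; rewrite prednK.
Qed.

End NilpotentSymbols.

(** * Weights of an adjoint map *)

Section Weights.
Context {K : numClosedFieldType} {X : normedModType K} (br : X -> X -> X).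
Hypothesis lie : is_lie_bracket br.
Context (L0 : set X).
Hypothesis sL0 : is_subspace L0.
Hypothesis aL0 : forall a b, L0 a -> L0 b -> L0 (br a b).
Hypothesis fL0 : finite_codim [set: X] L0.
Context (x : X).
Hypothesis L0x : L0 x.
Implicit Types (u v w y z e : X) (k lam mu nu : K) (s t : seq K) (A B : set K).

Local Notation word := (word br).
Local Notation fil := (fil br L0).

Definition shift mu z := br x z - mu *: z.
Definition shifts s z := foldr shift z s.

Lemma shifts_cat s t z : shifts (s ++ t) z = shifts s (shifts t z).
Proof. by rewrite /shifts foldr_cat. Qed.

Lemma shiftD mu u v : shift mu (u + v) = shift mu u + shift mu v.
Proof. by rewrite /shift (brDr lie) scalerDr; abel. Qed.

Lemma shiftZ mu k u : shift mu (k *: u) = k *: shift mu u.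
Proof. by rewrite /shift (brZr lie) scalerBr !scalerA mulrC. Qed.

Lemma shiftsD s u v : shifts s (u + v) = shifts s u + shifts s v.
Proof. by elim: s => //= mu s ->; rewrite shiftD. Qed.

Lemma shiftC mu nu z : shift mu (shift nu z) = shift nu (shift mu z).
Proof.
rewrite /shift !(brBr lie) !(brZr lie) !scalerBr !scalerA [mu * nu]mulrC.
abel.
Qed.

Lemma shifts_shift s mu z : shifts s (shift mu z) = shift mu (shifts s z).
Proof. by elim: s => //= nu s ->; rewrite shiftC. Qed.

Lemma shiftsC s t z : shifts s (shifts t z) = shifts t (shifts s z).
Proof. by elim: s => //= mu s ->; rewrite shifts_shift. Qed.

Lemma fil_shift n mu z : fil n z -> fil n (shift mu z).
Proof.
move=> hz; have sF := fil_subspace lie sL0 n; apply: subspaceB => //.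
  exact: (fil_L0_br lie).
exact: subspaceZ.
Qed.

Lemma fil_shifts n s z : fil n z -> fil n (shifts s z).
Proof. by move=> hz; elim: s => //= mu s; exact: fil_shift. Qed.

(** Modulo [fil n], [z] is a sum of generalized eigenvectors of [ad x] with eigenvalues in [A],
    expressed by an annihilating product of linear factors. *)
Definition weights_in n A z :=
  exists2 s, (forall mu, mu \in s -> A mu) & fil n (shifts s z).

Lemma weights_in_fil n A z : fil n z -> weights_in n A z.
Proof. by exists [::]. Qed.

Lemma weights_inD n A u v : weights_in n A u -> weights_in n A v ->
  weights_in n A (u + v).
Proof.
move=> [s As us] [t At vt]; exists (s ++ t).
  by move=> mu; rewrite mem_cat => /orP[]; [exact: As|exact: At].
rewrite shiftsD !shifts_cat [shifts s (shifts t u)]shiftsC.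
apply: subspaceD; first exact: fil_subspace.
  exact: fil_shifts.
exact: fil_shifts.
Qed.

Lemma weights_in_shift n A mu z : A mu -> weights_in n A (shift mu z) ->
  weights_in n A z.
Proof.
move=> Amu [s As hs]; exists (rcons s mu); last by rewrite -cats1 shifts_cat.
by move=> nu; rewrite mem_rcons inE => /predU1P[->//|]; exact: As.
Qed.

Lemma shift_br lam mu e z :
  shift (mu + lam) (br e z) = br (shift lam e) z + br e (shift mu z).
Proof.
rewrite /shift (br_derivation lie) (brBl lie) (brBr lie) (brZl lie) (brZr lie).
by rewrite scalerDl; abel.
Qed.

(** Eigenvalues add under the bracket. Each shift of [br e z] lowers the exponent [r] or shortens
    the list of [z], whence the double induction; bracketing loses one stage. *)
Lemma weights_in_br m n r lam A e z : (n < m)%N ->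
  fil m (iter r (shift lam) e) -> weights_in n.+1 A z ->
  weights_in n [set nu | A (nu - lam)] (br e z).
Proof.
move=> nm; elim: r e z => [|r IHr] e z he [s].
  move=> _ _; apply: weights_in_fil; apply: (fil_brl lie sL0).
  exact: fil_le he.
elim: s z => [|mu s IHs] z As /= hs.
  by apply: weights_in_fil; exact: fil_br.
apply: (@weights_in_shift _ _ (mu + lam)).
  by rewrite /= addrK; apply: As; rewrite mem_head.
rewrite shift_br; apply: weights_inD.
  by apply: IHr; [rewrite -iterSr|exists (mu :: s)].
apply: IHs; first by move=> nu nus; apply: As; rewrite inE nus orbT.
by rewrite shifts_shift.
Qed.

Lemma weights_in_word m n p r lam A e z : (n + p <= m)%N ->
  fil m (iter r (shift lam) e) -> weights_in (n + p) A z ->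
  weights_in n [set nu | A (nu - p%:R * lam)] (word (nseq p e) z).
Proof.
move=> npm he; elim: p n A npm => [|p IH] n A npm hz.
  rewrite addn0 in hz; congr (weights_in n _ z): hz.
  by apply/seteqP; split=> nu /=; rewrite mul0r subr0.
rewrite [nseq _ _]/=; have := IH n.+1 A; rewrite addSnnS => /(_ npm hz).
move=> /(weights_in_br _ he) h /=.
have := h _; move=> /(_ _)[|s As hs]; first by apply: leq_trans npm; lia.
exists s => // mu /As /=; rewrite mulrSr mulrDl mul1r opprD.
by rewrite addrA addrAC.
Qed.

Context (B : set K).
Hypothesis HB : forall n z mu, ~ fil n z -> fil n (shift mu z) -> B mu.

(** A factor whose scalar is not an eigenvalue is injective modulo [fil n], so the annihilating
    factors can be removed one by one. *)
Lemma weights_out n A z : (forall mu, A mu -> ~ B mu) ->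
  weights_in n A z -> fil n z.
Proof.
move=> AB [s]; elim: s => //= mu s IH As hs; apply: IH.
  by move=> nu nus; apply: As; rewrite inE nus orbT.
by apply: contrapT => /HB /(_ hs); apply: AB; apply: As; rewrite mem_head.
Qed.

Lemma weights_in_B n s z : fil n (shifts s z) -> weights_in n B z.
Proof.
elim: s z => [|mu s IH] z /= hs; first exact: weights_in_fil.
have [Bmu|nBmu] := pselect (B mu).
  by apply: (weights_in_shift Bmu); apply: IH; rewrite shifts_shift.
by apply: IH; apply: contrapT => /HB /(_ hs).
Qed.

Definition peval (p : {poly K}) z := \sum_(i < size p) p`_i *: iter i (br x) z.

Lemma peval_widen (p : {poly K}) n z : (size p <= n)%N ->
  peval p z = \sum_(i < n) p`_i *: iter i (br x) z.
Proof.
move=> pn; rewrite /peval (big_ord_widen n (fun i => p`_i *: iter i (br x) z))//.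
rewrite big_mkcond; apply: eq_bigr => i _; case: ltnP => // hi.
by rewrite nth_default// scale0r.
Qed.

Lemma pevalMX (p : {poly K}) mu z : peval (p * ('X - mu%:P)) z = shift mu (peval p z).
Proof.
have s1 : (size (p * ('X - mu%:P))%R <= (size p).+1)%N.
  by apply: leq_trans (size_polyMleq _ _) _; rewrite size_XsubC addn2.
rewrite (peval_widen _ s1) /shift {1}/peval (peval_widen _ (leqnSn _)).
rewrite (br_sumr lie) scaler_sumr.
under eq_bigr => i _ do rewrite mulrBr coefB coefMX coefMC scalerBl.
rewrite sumrB; congr (_ - _); last first.
  by apply: eq_bigr => i _; rewrite scalerA mulrC.
rewrite big_ord_recl /= scale0r add0r; apply: eq_bigr => i _.
by rewrite (brZr lie).
Qed.

(** In [d] coordinates, [d + 1] iterates of [ad x] on [z] are dependent; the resulting polynomial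
    splits over the algebraically closed field. *)
Lemma shifts_exists n z : exists s, fil n (shifts s z).
Proof.
have [d [phi [lphi kphi]]] := fil_finite_codim lie sL0 aL0 n fL0.
have phi_sum m (c : 'I_m -> K) (v : 'I_m -> X) :
    phi (\sum_i c i *: v i) = \sum_i c i *: phi (v i).
  have phiD u w : phi (u + w) = phi u + phi w by have := lphi 1 u w I I; rewrite !scale1r.
  have phi0 : phi 0 = 0 by apply/kphi => //; apply: subspace0; exact: fil_subspace.
  rewrite (big_morph phi phiD phi0); apply: eq_bigr => i _.
  by have := lphi (c i) (v i) 0 I I; rewrite phi0 !addr0.
pose M := \matrix_(i < d.+1) phi (iter i (br x) z).
have : kermx M != 0.
  by rewrite kermx_eq0 /row_free neq_ltn ltnS rank_leq_col.
case/rowV0Pn => w /sub_kermxP wM w0.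
pose p := \poly_(i < d.+1) w 0 (inord i).
have pE (i : 'I_d.+1) : p`_i = w 0 i by rewrite coef_poly ltn_ord inord_val.
have p0 : p != 0.
  apply: contra_neq w0 => p0; apply/rowP => i.
  by rewrite -pE p0 coef0 mxE.
have pz : fil n (peval p z).
  apply/kphi => //; rewrite (@peval_widen _ d.+1); last exact: size_poly.
  rewrite phi_sum -[RHS]wM mulmx_sum_row; apply: eq_bigr => i _.
  by rewrite pE rowK.
have [r pr] := closed_field_poly_normal p.
exists r.
apply: (@subspaceZV _ _ _ (lead_coef p)); first exact: fil_subspace.
  by rewrite lead_coef_eq0.
suff -> : lead_coef p *: shifts r z = peval p z by [].
rewrite [in RHS]pr.
elim: r {pr} => [|mu r IH] /=.
  rewrite big_nil alg_polyC (peval_widen (n := 1)) ?size_polyC_leq1//.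
  by rewrite big_ord1 coefC.
rewrite big_cons mulrC scalerAl pevalMX -IH shiftZ.
by [].
Qed.

Lemma weights_in_all n z : weights_in n B z.
Proof. by have [s] := shifts_exists n z; exact: weights_in_B. Qed.

(** In a product annihilating [e], the factors with [mu] different from [lam] act on [e] modulo [L0]
    as nonzero scalars. Applying them leaves a vector outside [L0] killed by a power of the factor
    for [lam]. *)
Lemma eigenvector_lift n lam e : ~ L0 e -> L0 (shift lam e) ->
  exists e' r, ~ L0 e' /\ fil n (iter r (shift lam) e').
Proof.
have [s] := shifts_exists n e.
have : fil n (shifts s e) -> exists r, fil n (iter r (shift lam) (shifts s e)).
  by exists 0%N.
move=> /[apply].
elim: s e => [|mu s IH] e [r hr] ne he.
  by exists e, r.
have [mul|mul] := eqVneq mu lam.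
  by apply: (IH e) => //; exists r.+1; rewrite iterSr; move: hr; rewrite /= mul.
apply: (IH (shift mu e)).
- by exists r; rewrite shifts_shift.
- have -> : shift mu e = shift lam e + (lam - mu) *: e.
    by rewrite /shift scalerBl; abel.
  move=> /(subspaceDr sL0 he) /(subspaceZV sL0); rewrite subr_eq0 eq_sym => /(_ mul).
  exact: ne.
- by rewrite shiftC; have := @fil_shift 1 mu (shift lam e); rewrite fil1; apply.
Qed.

(** Apply annihilating factors to [z] until [ad x] becomes nilpotent on the result. The factor
    responsible has [mu != 0], and some iterate of [ad x] before it is an eigenvector. *)
Lemma nonzero_eigenvalue z : (forall n, ~ L0 (iter n (br x) z)) ->
  exists lam e, [/\ lam != 0, ~ L0 e & L0 (shift lam e)].
Proof.
have [s] := shifts_exists 1 z; rewrite fil1.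
elim: s z => [|mu s IH] z /= hs hz; first by have := hz 0%N.
have [nz|] := pselect (forall n, ~ L0 (iter n (br x) (shift mu z))).
  by apply: IH nz; rewrite shifts_shift.
move=> /existsNP[n /contrapT].
have -> : iter n (br x) (shift mu z) = shift mu (iter n (br x) z).
  elim: n => //= n ->; rewrite /shift (brBr lie) (brZr lie).
  by [].
have [->|mu0] := eqVneq mu 0.
  by rewrite /shift scale0r subr0 => /(hz n.+1).
by move=> h; exists mu, (iter n (br x) z).
Qed.

Lemma nilpotent_element z : (forall n, ~ L0 (iter n (br x) z)) ->
  (forall lam, lam != 0 -> exists p, forall mu, B mu -> ~ B (mu + p%:R * lam)) ->
  exists e p, ~ L0 e /\ forall y, fil p.+1 (word (nseq p e) y).
Proof.
move=> /nonzero_eigenvalue[lam [e0 [lam0 ne0 he0]]] /(_ lam lam0)[p hp].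
(* The [p] brackets with [e] cost [p] stages, and [p + 1] must remain. *)
have [e [r [ne he]]] := eigenvector_lift (p.+1 + p) ne0 he0.
exists e, p; split=> // y.
have := weights_in_word (leqnn _) he (weights_in_all (p.+1 + p) y).
apply: weights_out => mu /= Bmu.
by have := hp _ Bmu; rewrite subrK.
Qed.

End Weights.

(** * Engel's theorem and maximal subalgebras *)

Section Engel.
Context {K : numFieldType} {X : normedModType K} (br : X -> X -> X).
Hypothesis lie : is_lie_bracket br.
Context (L0 : set X).
Hypothesis sL0 : is_subspace L0.
Hypothesis aL0 : forall a b, L0 a -> L0 b -> L0 (br a b).
Hypothesis fL0 : finite_codim [set: X] L0.
Implicit Types (l u v w y z : X) (k : K) (A B H : set X).

Local Notation word := (word br).
Local Notation fil := (fil br L0).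

Lemma adjoin_br H y : is_subspace H -> (forall a b, H a -> H b -> H (br a b)) ->
  (forall l, H l -> H (br l y)) ->
  forall a b, adjoin H y a -> adjoin H y b -> adjoin H y (br a b).
Proof.
move=> sH aH Hy _ _ [l [k [Hl ->]]] [l' [k' [Hl' ->]]].
apply: sub_adjoin; rewrite (brDl lie) !(brDr lie) !(brZl lie) !(brZr lie) (brxx lie).
rewrite !scaler0 addr0; apply: subspaceD => //; last first.
  apply: subspaceZ => //; rewrite (br_anti lie); apply: subspaceN => //; exact: Hy.
by apply: subspaceD => //; [exact: aH|apply: subspaceZ => //; exact: Hy].
Qed.

(** Engel's theorem for [H] acting on [B] modulo [A]. Elements of [fil 2] act by zero, so the
    induction can start at [H = fil 2]. *)
Definition engel_property H := forall A B, is_subspace A -> is_subspace B ->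
  (exists2 b, B b & ~ A b) ->
  (forall l a, H l -> A a -> A (br l a)) ->
  (forall l b, H l -> B b -> B (br l b)) ->
  (forall l b, fil 2 l -> B b -> A (br l b)) ->
  (forall l b, H l -> B b -> exists n, A (iter n (br l) b)) ->
  exists b, [/\ B b, ~ A b & forall l, H l -> A (br l b)].

Lemma engel_base : engel_property (fil 2).
Proof. by move=> A B sA sB [b Bb nAb] _ _ AB _; exists b; split=> // l /AB; apply. Qed.

(** The vectors killed by [H] are stable under [y], which normalizes [H]; the last iterate of [br y]
    outside [A] is killed by [y] as well. *)
Lemma engel_adjoin H y : is_subspace H -> engel_property H ->
  (forall l, H l -> H (br l y)) -> engel_property (adjoin H y).
Proof.
move=> sH eH Hy A B sA sB AB HA HB FB nil.
have [|||b [Bb nAb hb]] := eH A B sA sB AB _ _ FB.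
- by move=> l a Hl; apply: HA; exact: sub_adjoin.
- by move=> l a Hl; apply: HB; exact: sub_adjoin.
- by move=> l a Hl; apply: nil; exact: sub_adjoin.
have Yy := adjoin_mem y sH.
have Bn n : B (iter n (br y) b) /\ forall l, H l -> A (br l (iter n (br y) b)).
  elim: n => [//|n [IH1 IH2]]; split; first exact: HB.
  move=> l Hl; rewrite /= (br_derivation lie); apply: subspaceD => //.
    by apply: IH2; exact: Hy.
  by apply: HA => //; exact: IH2.
have ex : exists n, `[< A (iter n (br y) b) >].
  by have [n hn] := nil _ _ Yy Bb; exists n; apply/asboolP.
case: (ex_minnP ex) => -[|n] /asboolP An minn; first by [].
exists (iter n (br y) b); split; first exact: (Bn n).1.
  by move=> /asboolP /minn; rewrite ltnn.
move=> _ [l [k [Hl ->]]]; rewrite (brDl lie) (brZl lie); apply: subspaceD => //.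
  exact: (Bn n).2.
exact: subspaceZ.
Qed.

Lemma iter_word n l z : iter n (br l) z = word (nseq n l) z.
Proof. by elim: n => //= n ->. Qed.

Lemma iter_br_L0 n l z : L0 l -> L0 z -> L0 (iter n (br l) z).
Proof. by move=> L0l L0z; elim: n => //= n; exact: aL0. Qed.

Lemma nilpotent_uniform l : L0 l -> (forall z, exists n, L0 (iter n (br l) z)) ->
  exists n, forall z, L0 (iter n (br l) z).
Proof.
move=> L0l nil.
have [d [e [_ _ ge]]] := finite_codim_quotient_dim subspaceT sL0 fL0.
have /choice[N hN] : forall i, exists n, L0 (iter n (br l) (e i)) by move=> i; exact: nil.
exists (\max_i N i)%N => z; have [c hc] := ge z I.
have oW := ord_nseq br (\max_i N i)%N l.
rewrite -(subrK (\sum_i c i *: e i) z) iter_word (ord_linearD lie _ _ oW).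
apply: subspaceD => //; first by rewrite -iter_word; exact: iter_br_L0.
rewrite (big_morph _ (fun u v => ord_linearD lie u v oW) (ord_linear0 lie oW)).
apply: subspace_sum => // i _; rewrite (ord_linearZ lie _ _ oW); apply: subspaceZ => //.
rewrite -iter_word -(subnK (leq_bigmax i)) iterD.
by apply: iter_br_L0.
Qed.

(** [L0] modulo [fil 2] acts faithfully on the quotient by [L0], and commutation with a nilpotent
    operator is nilpotent, with at most twice the exponent. *)
Lemma nilpotent_adjoint l y : L0 l -> L0 y ->
  (forall z, exists n, L0 (iter n (br l) z)) -> exists n, fil 2 (iter n (br l) y).
Proof.
move=> L0l L0y /(nilpotent_uniform L0l)[n hn]; exists (n + n)%N.
(* Leibniz terms: the [n + n] applications of [br l] are spread over three places, and once [m = 0]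
   one of [i] and [j] is at least [n]. *)
have H m i j z : (i + j + m = n + n)%N ->
    L0 (iter i (br l) (br (iter m (br l) y) (iter j (br l) z))).
  elim: m i j => [|m IH] i j ijm.
    have [ni|ni] := leqP n i; first by rewrite -(subnKC ni) iterD.
    apply: iter_br_L0 => //; apply: aL0 => //.
    have nj : (n <= j)%N by lia.
    by rewrite -(subnK nj) iterD; apply: iter_br_L0.
  have h1 := IH i.+1 j; have h2 := IH i j.+1.
  rewrite iterSr (br_derivation lie) in h1.
  rewrite [X in L0 X](_ : _ = iter i (br l) (br (br l (iter m (br l) y)) (iter j (br l) z)
      + br (iter m (br l) y) (br l (iter j (br l) z)))
      - iter i (br l) (br (iter m (br l) y) (iter j.+1 (br l) z))).
    by apply: subspaceB => //; [apply: h1|apply: h2]; lia.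
  rewrite !iter_word (ord_linearD lie _ _ (ord_nseq br i l)).
  by rewrite addrK.
apply/filSP; rewrite fil1.
split; [exact: iter_br_L0..|].
move=> z; rewrite (br_anti lie); apply: subspaceN => //.
exact: (H (n + n)%N 0%N 0%N z).
Qed.

(* By [engel_adjoin], a largest [H] with the property that has an element of [L0]
   outside [H] normalizing it could be enlarged. *)
Lemma engel_L0 : (forall l z, L0 l -> exists n, L0 (iter n (br l) z)) ->
  engel_property L0.
Proof.
move=> nil.
pose P n := `[< exists H, [/\ is_subspace H, forall a b, H a -> H b -> H (br a b),
  fil 2 `<=` H, H `<=` L0 & engel_property H /\ quotient_dim [set: X] H n] >].
have exP : exists n, P n.
  have sF := fil_subspace lie sL0 2.
  have [n hn] := finite_codim_quotient_dim subspaceT sF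
    (fil_finite_codim lie sL0 aL0 2 fL0).
  exists n; apply/asboolP; exists (fil 2); split=> //.
  - by move=> a b Fa Fb; apply: (fil_L0_br lie) => //; exact: fil_L0 Fa.
  - exact: fil_L0.
  - by split=> //; exact: engel_base.
case: (ex_minnP exP) => n /asboolP[H [sH aH FH HL [eH dH]]] minn.
have [<-//|HnL] := pselect (H = L0).
have [|||||y [L0y nHy Hy]] := eH H L0 sH sL0 => //.
- apply: contrapT => h; apply: HnL; apply/seteqP; split=> // z L0z.
  by apply: contrapT => nHz; apply: h; exists z.
- by move=> l b Hl L0b; apply: aL0 => //; exact: HL.
- move=> l b Fl L0b; apply: FH; rewrite (br_anti lie); apply: subspaceN.
    exact: fil_subspace.
  exact: (fil_L0_br lie).
- move=> l b Hl L0b.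
  have [|m hm] := @nilpotent_adjoint l b (HL _ Hl) L0b.
    by move=> z; apply: nil; exact: HL.
  by exists m; exact: FH.
have sH' := adjoin_subspace y sH.
have [m hm] : exists m, quotient_dim [set: X] (adjoin H y) m.
  apply: (finite_codim_quotient_dim subspaceT sH').
  apply: (finite_codim_super subspaceT sH' (@sub_adjoin _ _ H y)).
  exact: (quotient_dim_finite_codim subspaceT sH dH).
have mn : (m < n)%N.
  apply: (quotient_dim_lt subspaceT sH sH' _ _ _ hm dH) => //.
    exact: sub_adjoin.
  by move=> HH; apply: nHy; rewrite -HH; exact: adjoin_mem.
suff /minn : P m by rewrite leqNgt mn.
apply/asboolP; exists (adjoin H y); split=> //.
- exact: adjoin_br.
- by move=> z /FH; exact: sub_adjoin.
- by move=> _ [l [k [Hl ->]]]; apply: subspaceD => //; [exact: HL|exact: subspaceZ].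
- by split=> //; exact: engel_adjoin.
Qed.

Lemma engel_normalizer : L0 <> [set: X] ->
  (forall l z, L0 l -> exists n, L0 (iter n (br l) z)) ->
  exists2 v, ~ L0 v & forall l, L0 l -> L0 (br l v).
Proof.
move=> L0T nil.
have [|||||v [_ nv hv]] := engel_L0 nil sL0 subspaceT => //.
- apply: contrapT => h; apply: L0T; apply/seteqP; split=> // z _.
  by apply: contrapT => nz; apply: h; exists z.
- by move=> l b Fl _; have := fil_brl lie sL0 b Fl; rewrite fil1.
- by move=> l b Hl _; exact: nil.
by exists v.
Qed.

End Engel.

(** * Ideals in the filtration of a maximal subalgebra *)

Section MaximalSubalgebra.
Context {K : numClosedFieldType} {X : normedModType K} (br : X -> X -> X).
Hypothesis lie : is_lie_bracket br.
Context (L0 : set X).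
Hypothesis sL0 : is_subspace L0.
Hypothesis aL0 : forall a b, L0 a -> L0 b -> L0 (br a b).
Hypothesis fL0 : finite_codim [set: X] L0.
Hypothesis L0T : L0 <> [set: X].
Hypothesis maxL0 : forall S : set X, is_subspace S ->
  (forall a b, S a -> S b -> S (br a b)) -> L0 `<=` S ->
  (exists2 v, S v & ~ L0 v) -> S = [set: X].

Local Notation fil := (fil br L0).

(* The spectrum of [ad x] on the quotients by the filtration lies in a set [B]
   from which every arithmetic progression escapes. *)
Hypothesis spectrum : forall x, L0 x -> exists B : set K,
  (forall n z mu, ~ fil n z -> fil n (br x z - mu *: z) -> B mu) /\
  forall lam : K, lam != 0 -> exists p, forall mu, B mu -> ~ B (mu + p%:R * lam).

Lemma exists_fil_ideal : exists m, forall y z, fil m.+1 z -> fil m.+1 (br y z).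
Proof.
have [nil|] := pselect (forall l z, L0 l -> exists n, L0 (iter n (br l) z)).
  have [v nv hv] := engel_normalizer lie sL0 aL0 fL0 L0T nil.
  have ST : adjoin L0 v = [set: X].
    apply: maxL0; first exact: adjoin_subspace.
    - exact: adjoin_br.
    - exact: sub_adjoin.
    - by exists v => //; exact: adjoin_mem.
  exists 0%N; rewrite fil1 => y z L0z.
  have : adjoin L0 v y by rewrite ST.
  move=> [l [k [L0l ->]]]; rewrite (brDl lie) (brZl lie); apply: subspaceD => //.
    exact: aL0.
  apply: subspaceZ => //; rewrite (br_anti lie); apply: subspaceN => //; exact: hv.
move=> /existsNP[x /existsNP[z /not_implyP[L0x nz]]].
have {}nz n : ~ L0 (iter n (br x) z) by move=> h; apply: nz; exists n.
have [B [HB Bp]] := spectrum L0x.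
have [e [p [ne hp]]] := nilpotent_element lie sL0 aL0 fL0 L0x HB nz Bp.
pose U := nilpotent_symbol br L0.
have sU : is_subspace U by exact: nilpotent_symbol_subspace.
have UL0 : L0 `<=` U by exact: nilpotent_symbol_L0.
have UT (S : set X) : is_subspace S -> (forall a b, S a -> S b -> S (br a b)) ->
    L0 `<=` S -> S e -> forall y, S y.
  by move=> sS aS LS Se y; rewrite (maxL0 sS aS LS)//; exists e.
(* The normalizer of [U] is a subalgebra containing [L0] and [e], hence everything by maximality. *)
have normU y u : U u -> U (br y u).
  move=> Uu; move: y u Uu.
  apply: (UT [set y | forall u, U u -> U (br y u)]).
  - apply/is_subspaceP; split=> [u Uu|a v w hv hw u Uu].
      by rewrite (br0l lie); exact: subspace0.
    rewrite (brDl lie) (brZl lie); apply: subspaceD => //; last exact: hw.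
    by apply: subspaceZ => //; exact: hv.
  - move=> a b ha hb u Uu.
    rewrite (_ : br (br a b) u = br a (br b u) - br b (br a u)).
      by apply: subspaceB => //; [apply: ha; exact: hb|apply: hb; exact: ha].
    by rewrite [br a (br b u)](br_derivation lie) addrK.
  - by move=> l L0l u; exact: nilpotent_symbol_stable_L0.
  - move=> u Uu; rewrite (br_anti lie); apply: subspaceN => //.
    exact: nilpotent_symbol_br hp.
have Ue : U e by exists p => y _; apply: fil_L0; exact: hp.
have [m hm] := uniformly_goodT lie sL0 aL0 fL0 (UT U sU (fun a b _ => normU a b) UL0 Ue).
exists m => y z' /(fil_stationary lie sL0 hm).
exact: fil_br.
Qed.

End MaximalSubalgebra.

(** * Norms and closed subspaces *)

Section RealNorm.
Context {R : realType} {X : normedModType R[i]}.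
Implicit Types (u v y z : X) (k : R[i]) (Y S : set X).
Local Open Scope complex_scope.

(** Norms take values in the partially ordered field [R[i]]; the real part turns them into real
    numbers. *)
Definition rnorm z : R := complex.Re `|z|.
Definition rabs k : R := complex.Re `|k|.

Lemma rnormE z : `|z| = (rnorm z)%:C.
Proof. by rewrite /rnorm RRe_real// normr_real. Qed.

Lemma rabsE k : `|k| = (rabs k)%:C.
Proof. by rewrite /rabs RRe_real// normr_real. Qed.

Lemma rnorm_ge0 z : 0 <= rnorm z.
Proof. by rewrite -lecR -rnormE; exact: normr_ge0. Qed.

Lemma rabs_ge0 k : 0 <= rabs k.
Proof. by rewrite -lecR -rabsE; exact: normr_ge0. Qed.

Lemma rabs_gt0 k : k != 0 -> 0 < rabs k.
Proof. by move=> k0; rewrite -ltcR -rabsE; move: k0; rewrite -normr_gt0. Qed.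

Lemma rnormD u v : rnorm (u + v) <= rnorm u + rnorm v.
Proof. by rewrite -lecR rmorphD /= -!rnormE ler_normD. Qed.

Lemma rabsD k l : rabs (k + l) <= rabs k + rabs l.
Proof. by rewrite -lecR rmorphD /= -!rabsE ler_normD. Qed.

Lemma rnormZ k u : rnorm (k *: u) = rabs k * rnorm u.
Proof. by apply: complexI; rewrite rmorphM /= -!rnormE -rabsE normrZ. Qed.

Lemma rnormN u : rnorm (- u) = rnorm u.
Proof. by rewrite /rnorm normrN. Qed.

Lemma rabsN k : rabs (- k) = rabs k.
Proof. by rewrite /rabs normrN. Qed.

Lemma rabsM k l : rabs (k * l) = rabs k * rabs l.
Proof. by apply: complexI; rewrite rmorphM /= -!rabsE normrM. Qed.

Lemma rabs_nat n : rabs n%:R = n%:R.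
Proof. by apply: complexI; rewrite -rabsE normr_nat rmorph_nat. Qed.

Lemma closed_rnormP Y : closed Y <->
  forall z, (forall e : R, 0 < e -> exists2 y, Y y & rnorm (z - y) < e) -> Y z.
Proof.
split=> [cY z hz|hY z cz].
  apply: cY => B /nbhs_ballP[e /= e0 eB].
  have eE : e = (complex.Re e)%:C by rewrite RRe_real// gtr0_real.
  have [|y Yy zy] := hz (complex.Re e); first by rewrite -ltcR -eE.
  by exists y; split=> //; apply: eB; rewrite -ball_normE /= rnormE eE ltcR.
apply: hY => e e0; have [|y [Yy]] := cz (ball z e%:C).
  by apply/nbhs_ballP; exists e%:C => //=; rewrite ltcR.
by rewrite -ball_normE /= rnormE ltcR => zy; exists y.
Qed.

Lemma closed_distance Y z : closed Y -> ~ Y z ->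
  exists2 d : R, 0 < d & forall y, Y y -> d <= rnorm (z - y).
Proof.
move=> /closed_rnormP cY nYz; apply: contrapT => h; apply: nYz; apply: cY => e e0.
apply: contrapT => h'; apply: h; exists e => // y Yy.
by rewrite leNgt; apply/negP => ye; apply: h'; exists y.
Qed.

End RealNorm.

(** * Finite-dimensional extensions of closed subspaces *)

Section FiniteCodimension.
Context {R : realType}.
Local Open Scope complex_scope.

(** The intervals of radius [e n] around [u n] meet pairwise, so the supremum of their left
    endpoints lies in all of them. *)
Lemma real_limit (u e : nat -> R) :
  (forall m n, `|u m - u n| <= e m + e n) ->
  exists a, forall n, `|u n - a| <= e n.
Proof.
move=> ue; pose A := range (fun n => u n - e n).
have Aub m : ubound A (u m + e m).
  move=> _ [n _ <-]; have := ue n m; rewrite ler_norml => /andP[_]; lra.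
exists (sup A) => n.
have h1 : u n - e n <= sup A by apply: ub_le_sup; [exists (u 0%N + e 0%N)|exists n].
have h2 : sup A <= u n + e n by apply: ge_sup; [exists (u n - e n); exists n|].
by rewrite ler_norml; apply/andP; split; lra.
Qed.

Lemma rabs_Re (k : R[i]) : `|complex.Re k| <= rabs k.
Proof. by rewrite -lecR -rabsE normc_ge_Re. Qed.

Lemma rabs_real (a : R) : rabs a%:C = `|a|.
Proof. by rewrite /rabs normc_def /= expr0n /= addr0 sqrtr_sqr. Qed.

Lemma rabs_i (k : R[i]) : rabs ('i * k) = rabs k.
Proof.
by rewrite rabsM /rabs normc_def /= expr0n expr1n /= add0r sqrtr1 mul1r.
Qed.

Lemma rabs_Im (k : R[i]) : `|complex.Im k| <= rabs k.
Proof. by rewrite -(rabs_i k) mulrC -normrN -ReiNIm rabs_Re. Qed.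

Lemma rabs_le (k : R[i]) : rabs k <= `|complex.Re k| + `|complex.Im k|.
Proof.
by rewrite {1}(complexE k) (le_trans (rabsD _ _))// rabs_i !rabs_real.
Qed.

Lemma complex_limit (u : nat -> R[i]) (e : nat -> R) :
  (forall m n, rabs (u m - u n) <= e m + e n) ->
  exists a, forall n, rabs (u n - a) <= e n + e n.
Proof.
move=> ue.
have [|a ha] := @real_limit (fun n => complex.Re (u n)) e.
  by move=> m n; apply: le_trans (ue m n); rewrite -raddfB; exact: rabs_Re.
have [|b hb] := @real_limit (fun n => complex.Im (u n)) e.
  by move=> m n; apply: le_trans (ue m n); rewrite -raddfB; exact: rabs_Im.
exists (a +i* b) => n; apply: le_trans (rabs_le _) _.
by rewrite !raddfB /=; apply: lerD.
Qed.

Context {X : normedModType R[i]}.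
Implicit Types (Y S : set X).

(** The distance [d] from [v] to [Y] is positive, so the coefficient of [v] is controlled by the
    norm. The coefficients of vectors approaching [z] converge to some [c], and [z - c *: v] is a
    limit of points of [Y]. *)
Lemma closed_adjoin Y v : is_subspace Y -> closed Y -> closed (adjoin Y v).
Proof.
move=> sY cY; have [Yv|nYv] := pselect (Y v).
  rewrite (_ : adjoin Y v = Y)//; apply/seteqP; split; last exact: sub_adjoin.
  by move=> _ [l [k [Yl ->]]]; apply: subspaceD => //; exact: subspaceZ.
have [d d0 hd] := closed_distance cY nYv.
have coord y k : Y y -> rabs k * d <= rnorm (y + k *: v).
  move=> Yy; have [->|k0] := eqVneq k 0.
    by rewrite /rabs normr0 /= mul0r rnorm_ge0.
  have -> : y + k *: v = k *: (v - (- k^-1) *: y).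
    by rewrite scaleNr opprK scalerDr scalerA mulfV// scale1r addrC.
  by rewrite rnormZ ler_wpM2l ?rabs_ge0//; apply: hd; exact: subspaceZ.
apply/closed_rnormP => z hz.
have del0 n : 0 < n.+1%:R^-1 :> R by rewrite invr_gt0.
have /choice[f hf] : forall n, exists yk : X * R[i],
    Y yk.1 /\ rnorm (z - (yk.1 + yk.2 *: v)) < n.+1%:R^-1.
  by move=> n; have [_ [l [k [Yl ->]]] zlk] := hz _ (del0 n); exists (l, k).
have [|c hc] := @complex_limit (fun n => (f n).2) (fun n => n.+1%:R^-1 / d).
  move=> m n; rewrite -mulrDl ler_pdivlMr//.
  apply: le_trans (coord ((f m).1 - (f n).1) _ _) _.
    by apply: subspaceB => //; [exact: (hf m).1|exact: (hf n).1].
  have -> : (f m).1 - (f n).1 + ((f m).2 - (f n).2) *: v =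
      (z - ((f n).1 + (f n).2 *: v)) - (z - ((f m).1 + (f m).2 *: v)).
    by rewrite scalerBl; abel.
  apply: le_trans (rnormD _ _) _; rewrite rnormN addrC.
  by apply: lerD; apply: ltW; [exact: (hf m).2|exact: (hf n).2].
exists (z - c *: v), c; split; last by rewrite subrK.
move/closed_rnormP: cY; apply => e e0.
(* In units of [1 / (n + 1)], the approximation error is at most 1 and the error of the coefficient
   at most [2 / d]. *)
pose C := 1 + 2 / d * rnorm v.
have C0 : 0 < C.
  by rewrite ltr_pwDl// mulr_ge0 ?rnorm_ge0// divr_ge0// ltW.
pose n := Num.trunc (C / e); exists (f n).1; first exact: (hf n).1.
have Cn : C * n.+1%:R^-1 < e.
  rewrite ltr_pdivrMr// mulrC -ltr_pdivrMr//.
  by rewrite /n truncnS_gt.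
apply: le_lt_trans Cn.
have -> : z - c *: v - (f n).1 = (z - ((f n).1 + (f n).2 *: v)) + ((f n).2 - c) *: v.
  by rewrite scalerBl; abel.
apply: le_trans (rnormD _ _) _.
rewrite /C mulrDl mul1r; apply: lerD; first exact/ltW/(hf n).2.
rewrite rnormZ mulrAC ler_wpM2r ?rnorm_ge0//.
apply: le_trans (hc n) _; set t := _.+1%:R^-1.
by rewrite (_ : t / d + t / d = 2 / d * t) //; ring.
Qed.

(** [S] arises from [Y] by adjoining finitely many vectors, one at a time. *)
Lemma closed_super Y S : is_subspace Y -> closed Y -> is_subspace S ->
  Y `<=` S -> finite_codim [set: X] Y -> closed S.
Proof.
move=> sY cY sS YS fY.
have [n [e [Se _ ge]]] := finite_codim_quotient_dim sS sY
  (finite_codim_sub (@subsetT _ S) fY).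
pose T (r : seq 'I_n) := [set z | exists c : 'I_n -> R[i],
  Y (z - \sum_(i <- r) c i *: e i)].
have -> : S = T (enum 'I_n).
  apply/seteqP; split=> z.
    by move=> /ge[c hc]; exists c; rewrite big_enum.
  move=> [c /YS]; rewrite big_enum /= => hc; apply: (subspaceDl sS _ hc).
  apply: subspaceN => //; apply: subspace_sum => // i _; exact: subspaceZ.
elim: (enum 'I_n) (enum_uniq 'I_n) => [|i r IH] /=.
  move=> _; rewrite (_ : T [::] = Y)//; apply/seteqP; split=> z.
    by move=> [c]; rewrite big_nil subr0.
  by move=> Yz; exists (fun=> 0); rewrite big_nil subr0.
move=> /andP[ir ur].
have sT : is_subspace (T r).
  apply/is_subspaceP; split=> [|a u v [c hc] [c' hc']].
    exists (fun=> 0); rewrite big1 ?subr0; first exact: subspace0.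
    by move=> j _; rewrite scale0r.
  exists (fun j => a * c j + c' j).
  under eq_bigr do rewrite scalerDl -scalerA.
  rewrite big_split /= -scaler_sumr opprD addrACA -scalerBr.
  by apply: subspaceD => //; exact: subspaceZ.
rewrite (_ : T (i :: r) = adjoin (T r) (e i)).
  by apply: closed_adjoin => //; exact: IH.
apply/seteqP; split=> z.
  move=> [c]; rewrite big_cons => hc; exists (z - c i *: e i), (c i).
  by split; [exists c; move: hc; rewrite opprD addrA|rewrite subrK].
move=> [l [k [[c hc] ->]]]; exists (fun j => if j == i then k else c j).
rewrite big_cons eqxx; move: hc; congr Y.
have -> : \sum_(j <- r) (if j == i then k else c j) *: e j = \sum_(j <- r) c j *: e j.
  apply: eq_big_seq => j jr; case: eqP => // ji.
  by move: ir; rewrite -ji jr.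
abel.
Qed.

End FiniteCodimension.

(** * Ideals of finite codimension *)

Section NormedLie.
Context {R : realType} {X : normedModType R[i]} (br : X -> X -> X).
Hypothesis lie : is_lie_bracket br.
Context (t : R).
Hypothesis t0 : 0 < t.
Hypothesis br_bound : forall a b, rnorm (br a b) <= t * rnorm a * rnorm b.
Implicit Types (x y z : X) (Y J : set X).

Lemma closed_br_preimage Y y : is_subspace Y -> closed Y ->
  closed [set z | Y (br y z)].
Proof.
move=> sY cY; apply/closed_rnormP => z hz.
move/closed_rnormP: cY => cY /=; apply: cY => e e0.
(* The summand 1 keeps the divisor positive when [y = 0]. *)
have ty : 0 < t * rnorm y + 1 by rewrite ltr_wpDl// mulr_ge0 ?rnorm_ge0 ?ltW.
have [|w Yw zw] := hz (e / (t * rnorm y + 1)); first by rewrite divr_gt0.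
exists (br y w) => //; rewrite -(brBr lie).
apply: le_lt_trans (br_bound _ _) _.
apply: (@le_lt_trans _ _ ((t * rnorm y + 1) * rnorm (z - w))).
  by rewrite ler_wpM2r ?rnorm_ge0// lerDl.
by rewrite mulrC -ltr_pdivlMr.
Qed.

Lemma closed_fil L0 n : is_subspace L0 -> closed L0 -> closed (fil br L0 n).
Proof.
move=> sL0 cL0; elim: n => [|n IH]; first exact: closedT.
rewrite (_ : fil br L0 n.+1 = L0 `&` fil br L0 n `&`
    \bigcap_(y in [set: X]) [set z | fil br L0 n (br y z)]).
  apply: closedI; first exact: closedI.
  by apply: closed_bigI => y _; apply: closed_br_preimage => //; exact: fil_subspace.
apply/seteqP; split=> z.
  by move=> /filSP[h1 h2 h3]; split=> // y _; exact: h3.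
by move=> [[h1 h2] h3]; apply/filSP; split=> // y; exact: h3.
Qed.

(** [ad x] acts on the quotient by [Y] with norm at most [t * rnorm x], which bounds its
    eigenvalues. *)
Lemma spectrum_bound Y x z (mu : R[i]) : is_subspace Y -> closed Y ->
  (forall y, Y y -> Y (br x y)) ->
  ~ Y z -> Y (br x z - mu *: z) -> rabs mu <= t * rnorm x.
Proof.
move=> sY cY xY nYz Yz.
have [d d0 hd] := closed_distance cY nYz.
rewrite leNgt; apply/negP => mux.
have mu0 : 0 < rabs mu by apply: le_lt_trans mux; rewrite mulr_ge0 ?rnorm_ge0 ?ltW.
have muN0 : mu != 0.
  by apply: contraTneq mu0 => ->; rewrite /rabs normr0 /= ltxx.
(* The infimum of [D] is the quotient norm of [z], positive because [Y] is closed. *)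
pose D := [set rnorm (z - y) | y in Y].
have D0 : D !=set0 by exists (rnorm (z - 0)); exists 0 => //; exact: subspace0.
have dD : d <= inf D by apply: lb_le_inf => // _ [y Yy <-]; exact: hd.
have Dlb : has_lbound D by exists d => _ [y Yy <-]; exact: hd.
suff : rabs mu * inf D <= t * rnorm x * inf D.
  by rewrite ler_pM2r ?leNgt ?mux//; exact: lt_le_trans dD.
have step y : Y y -> rabs mu * inf D <= t * rnorm x * rnorm (z - y).
  move=> Yy; apply: le_trans (br_bound x (z - y)).
  have -> : br x (z - y) = mu *: (z - mu^-1 *: (br x y - (br x z - mu *: z))).
    rewrite scalerBr scalerA mulfV// scale1r (brBr lie); abel.
  rewrite rnormZ ler_wpM2l ?rabs_ge0//; apply: ge_inf => //.
  exists (mu^-1 *: (br x y - (br x z - mu *: z))) => //.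
  by apply: subspaceZ => //; apply: subspaceB => //; exact: xY.
have [tx0|tx0] := eqVneq (t * rnorm x) 0.
  by have := step 0 (subspace0 sY); rewrite tx0 !mul0r.
have tx : 0 < t * rnorm x by rewrite lt_def tx0 mulr_ge0 ?rnorm_ge0 ?ltW.
rewrite -ler_pdivrMl//; apply: lb_le_inf => // _ [y Yy <-].
by rewrite ler_pdivrMl//; exact: step.
Qed.

(** A translation longer than the diameter [M + M] moves the disc of radius [M] off itself. *)
Lemma escape (M : R) (lam : R[i]) : lam != 0 ->
  exists p : nat, forall mu, rabs mu <= M -> ~ rabs (mu + p%:R * lam) <= M.
Proof.
move=> /rabs_gt0 l0; exists (Num.trunc ((M + M) / rabs lam)).+1 => mu hmu hmul.
set p := _.+1 in hmul.
have : rabs (p%:R * lam) <= M + M.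
  rewrite (_ : p%:R * lam = (mu + p%:R * lam) + (- mu)); last by ring.
  by apply: le_trans (rabsD _ _) _; rewrite rabsN lerD.
rewrite rabsM rabs_nat -ler_pdivlMr// leNgt => /negP; apply.
exact: truncnS_gt.
Qed.

Theorem finite_codim_ideal Y : is_subspace Y -> closed Y ->
  (forall a b, Y a -> Y b -> Y (br a b)) -> Y <> [set: X] ->
  finite_codim [set: X] Y ->
  exists J, [/\ is_subspace J, closed J, forall y z, J z -> J (br y z),
    J <> [set: X] & finite_codim [set: X] J].
Proof.
move=> sY cY aY YT fY.
pose P n := `[< exists S : set X, [/\ is_subspace S, closed S,
  forall a b, S a -> S b -> S (br a b), S <> [set: X] & quotient_dim [set: X] S n] >].
have exP : exists n, P n.
  have [n hn] := finite_codim_quotient_dim subspaceT sY fY.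
  by exists n; apply/asboolP; exists Y.
case: (ex_minnP exP) => n /asboolP[L0 [sL0 cL0 aL0 LT dL0]] minn.
have fL0 := quotient_dim_finite_codim subspaceT sL0 dL0.
(* Every subspace above [L0] is closed, so minimal codimension among closed subalgebras gives
   maximality among all subalgebras. *)
have maxL0 (S : set X) : is_subspace S -> (forall a b, S a -> S b -> S (br a b)) ->
    L0 `<=` S -> (exists2 v, S v & ~ L0 v) -> S = [set: X].
  move=> sS aS LS [v Sv nLv]; apply: contrapT => ST.
  have cS : closed S by exact: closed_super fL0.
  have [m hm] := finite_codim_quotient_dim subspaceT sS
    (finite_codim_super subspaceT sS LS fL0).
  have mn : (m < n)%N.
    apply: (quotient_dim_lt subspaceT sL0 sS LS _ _ hm dL0) => //.
    by move=> SL; apply: nLv; rewrite -SL.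
  suff /minn : P m by rewrite leqNgt mn.
  by apply/asboolP; exists S.
have [|m hm] := exists_fil_ideal lie sL0 aL0 fL0 LT maxL0.
  move=> x L0x; exists [set mu | rabs mu <= t * rnorm x]; split.
    move=> k z mu; apply: spectrum_bound.
    - exact: fil_subspace.
    - exact: closed_fil.
    - by move=> y; exact: (fil_L0_br lie).
  by move=> lam /(escape (t * rnorm x)).
exists (fil br L0 m.+1); split=> //.
- exact: fil_subspace.
- exact: closed_fil.
- move=> FT; apply: LT; apply/seteqP; split=> // z _.
  by apply: (@fil_L0 _ _ br _ m); rewrite FT.
- exact: fil_finite_codim.
Qed.

End NormedLie.

(** * Closed subalgebras as normed Lie algebras *)

Section SubspaceType.
Context {R : realType} {X : normedModType R[i]} (M : set X).

(** Indexing the predicate by the proof of [is_subspace M] lets the submodule structure be attached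
    to it as an instance. *)
Definition subspace_pred & is_subspace M : {pred X} := fun x => x \in M.

Context (sM : is_subspace M).

HB.instance Definition _ :=
  GRing.isSubmodClosed.Build R[i] X (subspace_pred sM)
    (GRing.submod_closed_semi sM).

Definition subspace_type := {x : X | x \in subspace_pred sM}.

HB.instance Definition _ := SubType.on subspace_type.
HB.instance Definition _ := [Choice of subspace_type by <:].
HB.instance Definition _ := [SubChoice_isSubLmodule of subspace_type by <:].

Let norm (x : subspace_type) : R[i] := `|val x|.

Let ler_normD x y : norm (x + y) <= norm x + norm y.
Proof. exact: ler_normD. Qed.
Let normrZ (l : R[i]) x : norm (l *: x) = `|l| * norm x.
Proof. exact: normrZ. Qed.
Let normr0_eq0 x : norm x = 0 -> x = 0.
Proof. by move=> /normr0_eq0 x0; apply: val_inj. Qed.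

HB.instance Definition _ :=
  Lmodule_isNormed.Build R[i] subspace_type ler_normD normrZ normr0_eq0.

Lemma rnorm_val (x : subspace_type) : rnorm x = rnorm (val x).
Proof. by []. Qed.

Lemma subspace_typeP x : M x <-> exists u : subspace_type, val u = x.
Proof.
split=> [Mx|[u <-]]; last exact/set_mem/(valP u).
by exists (exist _ x (mem_set Mx)).
Qed.

Lemma val_mem (u : subspace_type) : M (val u).
Proof. by apply/subspace_typeP; exists u. Qed.

End SubspaceType.

Section ClosedSubalgebra.
Context {R : realType} {L : banachLieType R}.
Implicit Types (M J Y : set L).

Lemma bracket_is_lie : is_lie_bracket (@bracket R L).
Proof.
by split; [exact: bracket_linearl|exact: bracket_linearr|exact: bracketxx|
  exact: bracket_jacobi].
Qed.

Lemma bracket_rnorm : exists2 t : R, 0 < t &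
  forall a b : L, rnorm (bracket a b) <= t * rnorm a * rnorm b.
Proof.
have [t t0 ht] := @bracket_bounded R L; exists (complex.Re t).
  by rewrite -ltcR RRe_real// gtr0_real.
move=> a b; rewrite -lecR !rmorphM /= -!rnormE RRe_real ?ht//.
exact: gtr0_real.
Qed.

(** [finite_codim_ideal] is applied to [M] as a normed space with the restricted bracket, and the
    ideal is carried back to [L]. *)
Lemma closed_subalgebra_ideal M Y : closed M -> lie_subalgebra M ->
  closed Y -> lie_subalgebra Y -> Y `<=` M -> Y <> M -> finite_codim M Y ->
  exists J, [/\ lie_ideal M J, closed J, J <> M & exists n, quotient_dim M J n].
Proof.
move=> cM [sM aM] cY [sY aY] YM neqYM [n [phi [lphi kphi]]].
pose U : normedModType R[i] := subspace_type sM.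
have aU (a b : U) : bracket (val a) (val b) \in subspace_pred sM.
  by apply/mem_set; apply: aM; exact: val_mem.
pose brU (a b : U) : U := exist _ (bracket (val a) (val b)) (aU a b).
have valZD k (a b : U) : val (k *: a + b) = k *: val a + val b by [].
have lieL := bracket_is_lie.
have lieU : is_lie_bracket brU.
  split=> [b k a a'|a k b b'|a|a b c]; apply: val_inj => /=.
  - exact: bracket_linearl.
  - exact: bracket_linearr.
  - exact: bracketxx.
  - exact: bracket_jacobi.
have [t t0 ht] := bracket_rnorm.
have [||||||J [sJ cJ iJ JT fJ]] :=
  @finite_codim_ideal R U brU lieU t t0 _ [set u | Y (val u)].
- by move=> a b; exact: ht.
- apply/is_subspaceP; split; first exact: subspace0 sY.
  move=> k a b Ya Yb; change (Y (k *: val a + val b)).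
  by apply: subspaceD => //; exact: subspaceZ.
- apply/closed_rnormP => z hz; move/closed_rnormP: cY; apply => e /hz[y Yy zy].
  by exists (val y).
- by move=> a b; exact: aY.
- move=> YT; apply: neqYM; apply/seteqP; split=> // z /(subspace_typeP sM)[u <-].
  by have : [set u | Y (val u)] u by rewrite YT.
- exists n, (phi \o val); split=> [k a b _ _|z _] /=.
    by rewrite -lphi//; exact: val_mem.
  by apply: kphi; exact: val_mem.
pose J' : set L := [set val u | u in J].
have sJ' : is_subspace J'.
  apply/is_subspaceP; split; first by exists 0; [exact: subspace0|].
  move=> k _ _ [u Ju <-] [v Jv <-]; exists (k *: u + v) => //.
  by apply: subspaceD => //; exact: subspaceZ.
exists J'; split.
- split=> // [_ [u Ju <-]|a _ Ma [u Ju <-]]; first exact: val_mem.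
  have [a' a'a] := (subspace_typeP sM a).1 Ma.
  by exists (brU a' u); [exact: iJ|rewrite /= a'a].
- apply/closed_rnormP => z hz.
  have : M z.
    move/closed_rnormP: cM; apply => e /hz[_ [u Ju <-] zu].
    by exists (val u) => //; exact: val_mem.
  move=> /(subspace_typeP sM)[w wz]; exists w => //.
  move/closed_rnormP: cJ; apply => e /hz[_ [u Ju <-] zu].
  by exists u => //; rewrite rnorm_val /= -wz in zu *.
- move=> JM; apply: JT; apply/seteqP; split=> // u _.
  by have : J' (val u) by [rewrite JM; exact: val_mem] => -[v Jv /val_inj <-].
- apply: finite_codim_quotient_dim => //.
  have [m [psi [lpsi kpsi]]] := fJ.
  (* Vectors outside [M] get the default value 0; linearity is required only on [M]. *)
  exists m, (fun z => oapp psi 0 (insub z : option U)); split.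
    move=> k _ _ /(subspace_typeP sM)[u <-] /(subspace_typeP sM)[v <-].
    rewrite -valZD !valK /=; exact: lpsi.
  move=> _ /(subspace_typeP sM)[u <-]; rewrite valK /= kpsi//.
  by split=> [Ju|[v Jv /val_inj <-]//]; exists u.
Qed.

End ClosedSubalgebra.

(** * Transfinite iteration *)

Section Tower.
Context {X : Type} (f : set X -> set X).
Hypothesis f_sub : forall Z, f Z `<=` Z.
Implicit Types (Y Z c d m : set X) (G D : set (set X)).

(* The stages of the transfinite iteration of [f] from the top, without ordinals. *)
Definition tower : set (set X) := [set Z | forall G, G [set: X] ->
  (forall Y, G Y -> G (f Y)) ->
  (forall D, D !=set0 -> D `<=` G -> G (\bigcap_(Y in D) Y)) -> G Z].

Lemma tower_top : tower [set: X].
Proof. by []. Qed.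

Lemma tower_step c : tower c -> tower (f c).
Proof. by move=> tc G GT Gf GI; exact: (Gf c (tc G GT Gf GI)). Qed.

Lemma tower_inf D : D !=set0 -> D `<=` tower -> tower (\bigcap_(Y in D) Y).
Proof.
move=> D0 DC G GT Gf GI; apply: (GI D D0) => Y DY.
exact: (DC Y DY G GT Gf GI).
Qed.

Lemma tower_ind G : G [set: X] -> (forall c, tower c -> G c -> G (f c)) ->
  (forall D, D !=set0 -> D `<=` tower -> D `<=` G -> G (\bigcap_(Y in D) Y)) ->
  forall c, tower c -> G c.
Proof.
move=> GT Gf GI c tc; have [//] : tower c /\ G c.
apply: (tc [set c | tower c /\ G c]); first by split=> //; exact: tower_top.
  by move=> Y [tY GY]; split; [exact: tower_step|exact: Gf].
move=> D D0 DG.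
have DT : D `<=` tower by move=> Y /DG[].
by split; [exact: tower_inf|apply: GI => // Y /DG[]].
Qed.


(** The notion from the Bourbaki-Witt argument, with inclusion reversed: a step from strictly above
    [c] never jumps past [c]. *)
Definition extreme c := forall d, tower d -> c `<` d -> c `<=` f d.

Lemma extreme_compare c : tower c -> extreme c ->
  forall d, tower d -> d `<=` f c \/ c `<=` d.
Proof.
move=> tc ec; apply: tower_ind.
- by right.
- move=> Y tY [Yfc|cY].
    by left; apply: subset_trans Yfc; exact: f_sub.
  have [<-|cneqY] := pselect (c = Y); first by left.
  right; apply: ec => //; split=> // Yc.
  by apply: cneqY; apply/seteqP; split.
- move=> D D0 DT DG.
  have [[Y [DY Yfc]]|h] := pselect (exists Y, D Y /\ Y `<=` f c).
    by left; apply: subset_trans Yfc; exact: bigcap_inf.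
  right; apply: sub_bigcap => Y DY.
  by have [Yfc|//] := DG _ DY; case: h; exists Y.
Qed.

Lemma tower_extreme c : tower c -> extreme c.
Proof.
move: c; apply: tower_ind.
- by move=> d td [_ nT]; case: nT => x.
- move=> c tc ec d td [fcd ndfc].
  have [//|cd] := extreme_compare tc ec td.
  have [<-//|cneqd] := pselect (c = d).
  apply: subset_trans (f_sub (Z := c)) _; apply: ec => //; split=> // dc.
  by apply: cneqd; apply/seteqP; split.
- move=> D D0 DT De d td [Dd ndD].
  have [c Dc ndc] : exists2 c, D c & ~ (d `<=` c).
    apply: contrapT => h; apply: ndD; apply: sub_bigcap => c Dc.
    by apply: contrapT => ndc; apply: h; exists c.
  have tc := DT _ Dc; have ec := De _ Dc.
  have [dfc|cd] := extreme_compare tc ec td.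
    by case: ndc; apply: subset_trans dfc _; exact: f_sub.
  apply: subset_trans (bigcap_inf Dc) _.
  by apply: ec.
Qed.

Lemma tower_compare c d : tower c -> tower d -> d `<=` f c \/ c `<=` d.
Proof. by move=> tc; apply: extreme_compare => //; exact: tower_extreme. Qed.

Lemma tower_total : total_on tower subset.
Proof.
move=> c d tc td; have [dfc|cd] := tower_compare tc td; last by left.
by right; apply: subset_trans dfc _; exact: f_sub.
Qed.

Lemma tower_fixpoint_min m c : tower m -> f m = m -> tower c -> m `<=` c.
Proof.
move=> tm fm; move: c; apply: tower_ind => // [c tc mc|D D0 DT DG].
  have [<-|mneqc] := pselect (m = c); first by rewrite fm.
  apply: tower_extreme => //; split=> // cm.
  by apply: mneqc; apply/seteqP; split.
by apply: sub_bigcap => Y /DG.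
Qed.

(** Let [m] be the least stage above [D]. If [m] is not in [D], then [f m] is also above [D], so [m]
    is fixed and hence the smallest stage, which is absurd. Thus reverse inclusion well-orders the
    stages. *)
Lemma tower_maximum D : D !=set0 -> D `<=` tower ->
  exists2 m, D m & forall d, D d -> d `<=` m.
Proof.
move=> D0 DC.
pose B := [set c | tower c /\ forall d, D d -> d `<=` c].
have B0 : B !=set0 by exists [set: X]; split=> //; exact: tower_top.
have BC : B `<=` tower by move=> c [].
have tm := tower_inf B0 BC; set m := \bigcap_(Y in B) Y in tm.
have Dm d : D d -> d `<=` m by move=> Dd; apply: sub_bigcap => c [_]; exact.
have [//|nDm] := pselect (D m); first by exists m.
have ndm d : D d -> ~ (m `<=` d).
  by move=> Dd md; apply: nDm; rewrite (_ : m = d)//; apply/seteqP; split=> //; exact: Dm.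
have Bfm : B (f m).
  split; first exact: tower_step.
  by move=> d Dd; have [//|/(ndm _ Dd)] := tower_compare tm (DC _ Dd).
have fm : f m = m.
  by apply/seteqP; split; [exact: f_sub|exact: bigcap_inf].
have [d Dd] := D0; case: (ndm d Dd).
by apply: tower_fixpoint_min => //; exact: DC.
Qed.

Lemma tower_inf_fixed : let m := \bigcap_(Y in tower) Y in tower m /\ f m = m.
Proof.
have tm : tower (\bigcap_(Y in tower) Y).
  by apply: tower_inf => //; exists [set: X]; exact: tower_top.
split=> //; apply/seteqP; split; first exact: f_sub.
exact: bigcap_inf (tower_step tm).
Qed.

End Tower.

(** * Induction along a well-order *)

Section WellOrder.
Context {O : Type} (le : rel O).
Hypothesis wo : wochoice.well_order le.

Lemma well_order_ind (P : O -> Prop) :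
  (forall a, (forall b, le b a /\ b <> a -> P b) -> P a) -> forall a, P a.
Proof.
move=> IH a; apply: contrapT => nPa.
have [|z [[/asboolP nPz zmin] _]] := wo (A := [pred c | `[< ~ P c >]]).
  by exists a; apply/asboolP.
have lezz : le z z by apply: zmin; exact/asboolP.
apply: nPz; apply: IH => b [bz bneqz]; apply: contrapT => nPb.
have zb : le z b by apply: zmin; exact/asboolP.
have lebb : le b b.
  have [|y [[/asboolP yb ymin] _]] := wo (A := [pred c | `[< c = b >]]).
    by exists b; apply/asboolP.
  by rewrite -{1}yb; apply: ymin; exact/asboolP.
(* Antisymmetry comes from uniqueness of the minimum of a pair. *)
apply: bneqz; have [|w [_ wuniq]] := wo (A := [pred c | `[< c = b \/ c = z >]]).
  by exists b; apply/asboolP; left.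
have <- : w = b.
  apply: wuniq; split; first by apply/asboolP; left.
  by move=> c /asboolP[]->.
apply: wuniq; split; first by apply/asboolP; right.
by move=> c /asboolP[]->.
Qed.

End WellOrder.

(** * Frattini theory *)

Section Families.
Context {K : numFieldType} {X : normedModType K}.
Implicit Types (Y Z : set X) (G C D : set (set X)).

Lemma quotient_dim_self Y n : quotient_dim Y Y n -> n = 0%N.
Proof.
case: n => // n [e [Ye ie _]].
have := ie (fun i => (i == ord0)%:R); rewrite (bigD1 ord0)//= scale1r big1.
  by rewrite addr0 => /(_ (Ye ord0) ord0) /eqP; rewrite eqxx oner_eq0.
by move=> i /negPf ->; rewrite scale0r.
Qed.

Lemma gap_neq Y Z n : (0 < n)%N -> quotient_dim Z Y n -> Y <> Z.
Proof. by move=> n0 d YZ; move: d n0; rewrite YZ => /quotient_dim_self ->. Qed.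

Lemma family_inf0 G : (forall Y, G Y -> is_subspace Y) -> G [set 0] ->
  family_inf G = [set 0].
Proof.
move=> sG G0; apply/seteqP; split; first exact: bigcap_inf.
by move=> _ -> Y /sG/subspace0.
Qed.

Lemma family_supT G : G [set: X] -> family_sup G = [set: X].
Proof.
move=> GT; apply/seteqP; split=> // x _; apply: subset_closure.
exists 1%N, (fun=> x); split=> [_|]; first by exists [set: X].
by rewrite big_ord1.
Qed.

Lemma family_sup_max D Y : D Y -> (forall Z, D Z -> Z `<=` Y) ->
  is_closed_subspace Y -> family_sup D = Y.
Proof.
move=> DY hY [cY sY]; apply/seteqP; split.
  apply: subset_trans cY; apply: closure_subset => _ [n [v [hv ->]]].
  apply: subspace_sum => // i _; have [Z DZ Zv] := hv i.
  exact: hY DZ _ Zv.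
move=> y Yy; apply: subset_closure; exists 1%N, (fun=> y).
by split=> [_|]; [exists Y|rewrite big_ord1].
Qed.

(** Choose a lower neighbour of each nonzero member and iterate the choice transfinitely from the
    top. The stages form a chain, and the only fixed one is zero. *)
Lemma exists_complete_chain G : p_complete G -> lower_finite_gap G ->
  G [set: X] -> family_inf G = [set 0] ->
  exists C, [/\ C `<=` G, subspace_chain C, complete_family C,
    lower_finite_gap C & goes_from_to C [set 0] [set: X]].
Proof.
move=> [fG _ GI] [_ gapG] GT G0.
(* Outside [G] and at zero the choice is [Z] itself. *)
have /choice[f hf] : forall Z, exists Y, Y `<=` Z /\ (G Z -> G Y /\
    (Z <> [set 0] -> exists2 n, (0 < n)%N & quotient_dim Z Y n)).
  move=> Z; have [[GZ Z0]|h] := pselect (G Z /\ Z <> [set 0]).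
    have [|Y [GY YZ d]] := gapG Z GZ; first by rewrite G0.
    by exists Y; split=> // _; split.
  exists Z; split=> // GZ; split=> // Z0; by case: h.
have f_sub Z : f Z `<=` Z by have [] := hf Z.
have CG c : tower f c -> G c.
  apply: tower_ind => // [Y _ /(proj2 (hf Y))[]//|D D0 _ DG].
  exact: GI.
have fC : subspace_family (tower f).
  by split=> [|Y /CG/fG.2//]; exists [set: X]; exact: tower_top.
have [tm fm] := tower_inf_fixed f_sub.
have C0 : family_inf (tower f) = [set 0].
  apply: contrapT => m0.
  have [_ /(_ m0)[n n0 dn]] := (hf _).2 (CG _ tm).
  by apply: (gap_neq n0 dn); exact: fm.
have CT : tower f [set: X] by exact: tower_top.
have sC : family_sup (tower f) = [set: X] by exact: family_supT.
exists (tower f); split=> //.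
- by split=> //; exact: tower_total.
- split; split=> //; first by rewrite sC.
    by move=> D D0 DC; exact: tower_inf.
  move=> D D0 DC; have [m Dm mD] := tower_maximum f_sub D0 DC.
  have tmD := DC _ Dm; rewrite (family_sup_max Dm mD (fC.2 _ tmD)); exact: tmD.
- split=> // Z CZ; rewrite C0 => Z0.
  have [_ /(_ Z0)d] := (hf _).2 (CG _ CZ).
  by exists (f Z); split=> //; exact: tower_step.
Qed.

End Families.

(** * Frattini stages and families of subalgebras *)

Section Frattini.
Context {R : realType} {L : banachLieType R}.
Implicit Types (A I J M Y Z W : set L) (G : set (set L)).

Definition closed_ideal M := closed M /\ lie_ideal [set: L] M.

Lemma closed_idealT : closed_ideal [set: L].
Proof. by split; [exact: closedT|split=> //; exact: subspaceT]. Qed.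

Lemma closed_ideal_bigcap (T : Type) (D : set T) (F : T -> set L) :
  (forall i, D i -> closed_ideal (F i)) -> closed_ideal (\bigcap_(i in D) F i).
Proof.
move=> FD; split.
  by apply: closed_bigI => i /FD[].
split=> //.
  apply/is_subspaceP; split=> [i /FD[_ [/subspace0]]//|a u v hu hv i Di].
  have [_ [sF _ _]] := FD i Di; apply: subspaceD => //; last exact: hv.
  by apply: subspaceZ => //; exact: hu.
by move=> a x _ hx i Di; have [_ [_ _ iF]] := FD i Di; apply: iF => //; exact: hx.
Qed.

Lemma frattini_step_sub M : frattini_step M `<=` M.
Proof. by move=> x []. Qed.

(* If [J] is an ideal of finite codimension in the ideal [M], so is
   [{y in J | [a, y] in J}], since [ad a] is a derivation of [M]. *)
Lemma frattini_step_ideal M : closed_ideal M -> closed_ideal (frattini_step M).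
Proof.
move=> [cM [sM _ iM]].
have lieL := @bracket_is_lie R L; have [t t0 ht] := @bracket_rnorm R L.
split.
  by apply: closedI => //; apply: closed_bigI => J [].
split=> //.
  apply: subspaceI => //; apply: subspace_bigcap => J [[]]//.
move=> a x _ [Mx hx]; split; first exact: iM.
move=> J [[sJ JM iJ] cJ neqJM [n dn]].
pose J1 := J `&` [set y | J (bracket a y)].
suff /hx[] : [/\ lie_ideal M J1, closed J1, J1 <> M
  & exists n, quotient_dim M J1 n] by [].
have sJ1 : is_subspace J1.
  apply: subspaceI => //; apply/is_subspaceP; split=> [|k u v Ju Jv] /=.
    by rewrite (br0r lieL); exact: subspace0.
  by rewrite (brDr lieL) (brZr lieL); apply: subspaceD => //; exact: subspaceZ.
split.
- split=> //; first by move=> y [/JM].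
  move=> m y Mm [Jy Jay]; split; first exact: iJ.
  rewrite /= (br_derivation lieL); apply: subspaceD => //; last exact: iJ.
  by apply: iJ => //; exact: iM.
- apply: closedI => //; exact: (closed_br_preimage lieL t0 ht).
- move=> J1M; apply: neqJM; apply/seteqP; split=> // y My.
  by have [] : J1 y by rewrite J1M.
- apply: finite_codim_quotient_dim => //.
  have fJ := quotient_dim_finite_codim sM sJ dn.
  apply: finite_codimI => //.
  apply: (finite_codim_preimage (Z' := M)) => //; first exact: bracket_linearr.
  by move=> z; exact: iM.
Qed.

Lemma frattini_tower_ideal M : tower frattini_step M -> closed_ideal M.
Proof.
move: M; apply: tower_ind; first exact: closed_idealT.
  by move=> c _; exact: frattini_step_ideal.
by move=> D _ _ DC; exact: closed_ideal_bigcap.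
Qed.

(** The stages under reverse inclusion serve as their own well-ordered index type, with the
    projection to sets as the sequence. *)
Lemma frattini_tower_fixed M : tower frattini_step M -> frattini_step M = M ->
  M `<=` frattini_radical L.
Proof.
move=> tM fM x Mx.
pose O := {Z : set L | tower frattini_step Z}.
pose le (a b : O) := `[< sval b `<=` sval a >].
have sval_inj (a b : O) : sval a = sval b -> a = b.
  by case: a b => [a ta] [b tb] /= ab; subst b; congr exist; exact: Prop_irrelevance.
have fsub := frattini_step_sub.
have ltP (a b : O) : le b a /\ b <> a <-> sval a `<` sval b.
  split=> [[/asboolP ab nab]|[ab nba]].
    split=> // ba; apply: nab; apply: sval_inj; exact/seteqP.
  by split; [exact/asboolP|move=> e; apply: nba; rewrite e].
exists O, le, (fun a => sval a), (exist _ M tM); split=> //.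
- move=> A [a0 Aa0].
  pose D := [set sval a | a in [set` A]].
  have [||_ [m Am <-] mD] := @tower_maximum _ _ fsub D.
  + by exists (sval a0); exists a0.
  + by move=> _ [a _ <-]; exact: svalP.
  exists m; split.
    by split=> // a Aa; apply/asboolP; apply: mD; exists a.
  move=> m' [Am' m'D]; apply: sval_inj; apply/seteqP; split.
    by move/asboolP: (m'D m Am).
  by apply: mD; exists m'.
- split.
  + move=> a nlt; apply: contrapT => aT.
    apply: (nlt (exist _ _ (@tower_top _ frattini_step))); apply/ltP; split=> //= Ta.
    by apply: aT; apply/seteqP; split.
  + move=> a b [/ltP[ab nba] hsucc].
    have [afb|ba//] := tower_compare fsub (svalP b) (svalP a).
    apply/seteqP; split=> //.
    apply: contrapT => nfba.
    have nfbb : frattini_step (sval b) <> sval b.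
      by move=> fbb; apply: nba; exact: tower_fixpoint_min (svalP b) fbb (svalP a).
    (* Without equality, the step after [b] would lie strictly between [b] and [a]. *)
    apply: (hsucc (exist _ _ (tower_step (svalP b)))); split; apply/ltP.
      by split=> //= bfb; apply: nfbb; apply/seteqP; split.
    by split.
  + move=> a [b0 b0a] nsucc.
    pose D := [set sval b | b in [set b | le b a /\ b <> a]].
    have DE : \bigcap_(b in [set b | le b a /\ b <> a]) sval b = \bigcap_(Y in D) Y.
      by rewrite bigcap_image.
    rewrite DE.
    have tD : tower frattini_step (\bigcap_(Y in D) Y).
      apply: tower_inf; first by exists (sval b0); exists b0.
      by move=> _ [b _ <-]; exact: svalP.
    have aD : sval a `<=` \bigcap_(Y in D) Y.
      by apply: sub_bigcap => _ [b /ltP[ab _] <-].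
    apply/seteqP; split=> //; apply: contrapT => nDa.
    (* Without equality, the intersection would be an immediate predecessor of [a]. *)
    apply: (nsucc (exist _ _ tD)); split; first by apply/ltP; split.
    move=> c [/ltP[/= cD nDc] ca]; apply: nDc.
    by apply: bigcap_inf; exists c.
Qed.

Lemma frattini_sequence_ideal (O : Type) (le : rel O) (P : O -> set L) :
  wochoice.well_order le -> frattini_sequence le P -> forall a, closed_ideal (P a).
Proof.
move=> wo [P0 PS Plim]; apply: (well_order_ind wo) => a IH.
have [[b ba]|nlt] := pselect (exists b, le b a /\ b <> a); last first.
  rewrite P0; first exact: closed_idealT.
  by move=> b hb; apply: nlt; exists b.
have [[c hc]|nsucc] := pselect (exists c, (le c a /\ c <> a) /\
    forall d, ~ ((le c d /\ c <> d) /\ (le d a /\ d <> a))).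
  by rewrite (PS _ _ hc); apply: frattini_step_ideal; apply: IH; case: hc.
rewrite Plim; first by apply: closed_ideal_bigcap => d; exact: IH.
- by exists b.
- by move=> c hc; apply: nsucc; exists c.
Qed.

Lemma lie_subalgebra_ideal M : lie_ideal [set: L] M -> lie_subalgebra M.
Proof. by move=> [sM _ iM]; split=> // a b _; exact: iM. Qed.

(** For a stable stage [M] with a nonzero vector, let [W] be the least member of [G] above [M] and
    [Y] a lower neighbour of [W]. The intersection of [M] and [Y] is a proper closed subalgebra of
    finite codimension in [M], so [M] also has such an ideal and is not stable. *)
Lemma frattini_semisimple_of_family G : G `<=` closed_lie_subalgebras L ->
  p_complete G -> lower_finite_gap G -> family_inf G = [set 0] ->
  family_sup G = [set: L] -> frattini_semisimple L.
Proof.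
move=> GL [_ GT GI] [_ gapG] G0 GsT; rewrite GsT in GT.
apply/seteqP; split=> [x [ O [le [P [a [wo fP fixP Px]]]]]|_ ->]; last first.
  (* Zero lies in the radical because the intersection of all stages is a stable stage. *)
  have [tm fm] := tower_inf_fixed frattini_step_sub.
  apply: (frattini_tower_fixed tm fm); have [_ [sm _ _]] := frattini_tower_ideal tm.
  exact: subspace0.
have [cM iM] := frattini_sequence_ideal wo fP a.
move: cM iM fixP Px; set M := P a => cM iM fixM Mx.
have [sM aM] := lie_subalgebra_ideal iM.
apply: contrapT => x0.
pose W := family_inf [set Z | G Z /\ M `<=` Z].
have MW : M `<=` W by apply: sub_bigcap => Z [].
have GW : G W by apply: GI => [|Z []//]; exists [set: L].
have [|Y [GY YW [n n0 dn]]] := gapG W GW.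
  by rewrite G0 => W0; apply: x0; rewrite -W0; exact: MW.
have nMY : ~ (M `<=` Y).
  move=> MY; apply: (gap_neq n0 dn); apply/seteqP; split=> //.
  exact: bigcap_inf.
have [_ [sW _]] := GL _ GW; have [cY [sY aY]] := GL _ GY.
have [|||||J [iJ cJ JM fJ]] := @closed_subalgebra_ideal _ _ M (M `&` Y) cM (conj sM aM).
- exact: closedI.
- split; first exact: subspaceI.
  by move=> b c [Mb Yb] [Mc Yc]; split; [exact: aM|exact: aY].
- by move=> z [].
- by move=> MYM; apply: nMY; rewrite -MYM => z [].
- apply: finite_codimI; first exact: finite_codim_self.
  by apply: (finite_codim_sub MW); exact: (quotient_dim_finite_codim sW sY dn).
apply: (JM); apply/seteqP; split; first by case: iJ.
by move=> z; rewrite -{1}fixM => -[_ h]; apply: h; split.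
Qed.

(** If [Z] lay in the step after the least stage [W] containing it, then [W] would be stable, hence
    inside the zero radical. *)
Lemma frattini_gap Z : frattini_semisimple L -> is_subspace Z -> Z <> [set 0] ->
  exists W J, [/\ closed_ideal W, lie_ideal W J, closed J, Z `<=` W
    & ~ (Z `<=` J) /\ finite_codim W J].
Proof.
move=> ss sZ Z0.
pose W := \bigcap_(c in [set c | tower frattini_step c /\ Z `<=` c]) c.
have tW : tower frattini_step W.
  apply: tower_inf => [|c []//]; exists [set: L]; split=> //; exact: tower_top.
have ZW : Z `<=` W by apply: sub_bigcap => c [].
have [cW iW] := frattini_tower_ideal tW.
have nZ : ~ (Z `<=` frattini_step W).
  move=> Zf; have fW : frattini_step W = W.
    apply/seteqP; split; first exact: frattini_step_sub.
    by apply: bigcap_inf; split=> //; exact: tower_step.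
  apply: Z0; apply/seteqP; split; last by move=> _ ->; exact: subspace0.
  by move=> z /ZW /(frattini_tower_fixed tW fW); rewrite ss.
have [z Zz nfz] : exists2 z, Z z & ~ frattini_step W z.
  apply: contrapT => h; apply: nZ => z Zz; apply: contrapT => nfz.
  by apply: h; exists z.
have [J [hJ nJz]] : exists J, [/\ lie_ideal W J, closed J, J <> W
    & exists n, quotient_dim W J n] /\ ~ J z.
  apply: contrapT => h; apply: nfz; split; first exact: ZW.
  by move=> J hJ; apply: contrapT => nJz; apply: h; exists J.
have [iJ cJ _ [n dn]] := hJ; exists W, J; split=> //; split; first by move=> /(_ _ Zz).
have [sW _ _] := iW; have [sJ _ _] := iJ.
exact: (quotient_dim_finite_codim sW sJ dn).
Qed.

Lemma gap_intersection Z W J : is_subspace Z -> is_subspace J -> Z `<=` W ->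
  ~ (Z `<=` J) -> finite_codim W J ->
  exists2 n, (0 < n)%N & quotient_dim Z (Z `&` J) n.
Proof.
move=> sZ sJ ZW nZJ fJ; have sZJ := subspaceI sZ sJ.
have fZJ : finite_codim Z (Z `&` J).
  by apply: finite_codimI; [exact: finite_codim_self|exact: finite_codim_sub fJ].
have [n dn] := finite_codim_quotient_dim sZ sZJ fZJ; exists n => //.
by apply: quotient_dim_gt0 dn => // ZZJ; apply: nZJ => z /ZZJ[].
Qed.

Lemma lie_ideal0 : lie_ideal [set: L] [set 0].
Proof.
have lieL := @bracket_is_lie R L; split=> //.
  by apply/is_subspaceP; split=> // a _ _ -> ->; rewrite scaler0 addr0.
by move=> a _ _ ->; rewrite /= (br0r lieL).
Qed.

Lemma closed0 : closed [set 0 : L].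
Proof.
apply/closed_rnormP => z hz; apply: contrapT => /eqP z0.
have [|_ -> ] := hz (rnorm z); last by rewrite subr0 ltxx.
by rewrite -ltcR -rnormE; move: z0; rewrite -normr_gt0.
Qed.

Lemma lie_ideal_refl M : lie_subalgebra M -> lie_ideal M M.
Proof. by move=> [sM aM]; split. Qed.

Lemma closed_lie_subideals2_ideal M : closed_ideal M -> closed_lie_subideals2 L M.
Proof.
move=> [cM iM]; split=> //; split; first exact: lie_subalgebra_ideal.
by exists M => //; apply: lie_ideal_refl; exact: lie_subalgebra_ideal.
Qed.

Lemma closed_lie_subideals2_sub : closed_lie_subideals2 L `<=` closed_lie_subalgebras L.
Proof. by move=> I [cI [aI _]]. Qed.

Lemma subspace_family_subalgebras G : G !=set0 -> G `<=` closed_lie_subalgebras L ->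
  subspace_family G.
Proof. by move=> G0 GL; split=> // Y /GL[cY [sY _]]. Qed.

(** Intersecting a choice of intermediate ideals of the members gives an intermediate ideal for the
    intersection. *)
Lemma closed_lie_subideals2_bigcap G : G `<=` closed_lie_subideals2 L ->
  closed_lie_subideals2 L (family_inf G).
Proof.
move=> GL.
have /choice[h hh] : forall Y, exists J, G Y -> lie_ideal [set: L] J /\ lie_ideal J Y.
  move=> Y; have [GY|nGY] := pselect (G Y); last by exists set0.
  by have [_ [_ [J iJ iY]]] := GL _ GY; exists J.
have sG : is_subspace (family_inf G).
  by apply: subspace_bigcap => Y /GL[_ [[]]].
split; first by apply: closed_bigI => Y /GL[].
split.
  split=> // a b ha hb Y GY; have [_ [[_ aY] _]] := GL _ GY.
  by apply: aY; [exact: ha|exact: hb].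
exists (\bigcap_(Y in G) h Y); split=> //.
- apply/is_subspaceP; split=> [Y /hh[[/subspace0]]//|a u v hu hv Y GY].
  have [[sJ _ _] _] := hh _ GY; apply: subspaceD => //; last exact: hv.
  by apply: subspaceZ => //; exact: hu.
- by move=> a x _ hx Y GY; have [[_ _ iJ] _] := hh _ GY; apply: iJ => //; exact: hx.
- by move=> z hz Y GY; have [_ [_ YJ _]] := hh _ GY; apply: YJ; exact: hz.
- move=> a x ha hx Y GY; have [_ [_ _ iY]] := hh _ GY.
  by apply: iY; [exact: ha|exact: hx].
Qed.

Lemma closed_lie_subalgebras_bigcap G : G `<=` closed_lie_subalgebras L ->
  closed_lie_subalgebras L (family_inf G).
Proof.
move=> GL; split; first by apply: closed_bigI => Y /GL[].
split; first by apply: subspace_bigcap => Y /GL[_ []].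
move=> a b ha hb Y GY; have [_ [_ aY]] := GL _ GY.
by apply: aY; [exact: ha|exact: hb].
Qed.

Lemma closed_ideal0 : closed_ideal [set 0].
Proof. by split; [exact: closed0|exact: lie_ideal0]. Qed.

Lemma subideals2_p_complete : p_complete (closed_lie_subideals2 L).
Proof.
have GT := closed_lie_subideals2_ideal closed_idealT.
split; last by move=> G _; exact: closed_lie_subideals2_bigcap.
  apply: subspace_family_subalgebras; first by exists [set: L].
  exact: closed_lie_subideals2_sub.
by rewrite family_supT.
Qed.

Lemma subalgebras_p_complete : p_complete (closed_lie_subalgebras L).
Proof.
have GT := closed_lie_subideals2_sub (closed_lie_subideals2_ideal closed_idealT).
split; last by move=> G _; exact: closed_lie_subalgebras_bigcap.
  by apply: subspace_family_subalgebras => //; exists [set: L].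
by rewrite family_supT.
Qed.

Lemma subalgebras_family_inf G : G `<=` closed_lie_subalgebras L ->
  closed_lie_subideals2 L `<=` G -> family_inf G = [set 0].
Proof.
move=> GL LG; apply: family_inf0 => [Y /GL[_ []]//|].
exact/LG/closed_lie_subideals2_ideal/closed_ideal0.
Qed.

Lemma subideals2_gap : frattini_semisimple L ->
  lower_finite_gap (closed_lie_subideals2 L).
Proof.
move=> ss; split; first by case: subideals2_p_complete.
rewrite subalgebras_family_inf//; last exact: closed_lie_subideals2_sub.
move=> Z [cZ [[sZ aZ] [I iI iZ]]] Z0.
have [W [J [[cW iW] iJ cJ ZW [nZJ fJ]]]] := frattini_gap ss sZ Z0.
have [sJ JW aJ] := iJ; have [sI _ aI] := iI; have [sW _ aW] := iW.
have [_ ZI aIZ] := iZ.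
exists (Z `&` J); split=> [|z []//|]; last exact: gap_intersection fJ.
split; first exact: closedI.
split.
  split; first exact: subspaceI.
  by move=> a b [Za Ja] [Zb Jb]; split; [exact: aZ|apply: aJ => //; exact: ZW].
(* [I] normalizes [Z] and [W] normalizes [J]; the intersection of these two ideals normalizes
   both. *)
exists (I `&` W).
  split=> //; first exact: subspaceI.
  by move=> a x _ [Ix Wx]; split; [exact: aI|exact: aW].
split; first exact: subspaceI.
  by move=> z [Zz _]; split; [exact: ZI|exact: ZW].
by move=> a x [Ia Wa] [Zx Jx]; split; [exact: aIZ|exact: aJ].
Qed.

Lemma subalgebras_gap : frattini_semisimple L ->
  lower_finite_gap (closed_lie_subalgebras L).
Proof.
move=> ss; split; first by case: subalgebras_p_complete.
rewrite subalgebras_family_inf//; last exact: closed_lie_subideals2_sub.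
move=> Z [cZ [sZ aZ]] Z0.
have [W [J [[cW iW] [sJ JW aJ] cJ ZW [nZJ fJ]]]] := frattini_gap ss sZ Z0.
exists (Z `&` J); split=> [|z []//|]; last exact: gap_intersection fJ.
split; first exact: closedI.
split; first exact: subspaceI.
by move=> a b [Za Ja] [Zb Jb]; split; [exact: aZ|apply: aJ => //; exact: ZW].
Qed.

End Frattini.

Theorem theorem8p6 (R : realType) (L : banachLieType R) :
  [<-> frattini_semisimple L;
       exists C : set (set L),
         [/\ C `<=` closed_lie_subideals2 L, subspace_chain C,
             complete_family C, lower_finite_gap C
           & goes_from_to C [set 0] [set: L]];
       exists C : set (set L),
         [/\ C `<=` closed_lie_subalgebras L, subspace_chain C,
             complete_family C, lower_finite_gap C
           & goes_from_to C [set 0] [set: L]];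
       p_complete (closed_lie_subideals2 L) /\
         lower_finite_gap (closed_lie_subideals2 L);
       p_complete (closed_lie_subalgebras L) /\
         lower_finite_gap (closed_lie_subalgebras L)].
Proof.
have sub := @closed_lie_subideals2_sub R L.
have T2 := closed_lie_subideals2_ideal (@closed_idealT R L).
(* The implications are proved in a cycle; both the passage from chains of subalgebras to subideals
   and that from subideals to subalgebras go through semisimplicity. *)
tfae.
- move=> ss; apply: exists_complete_chain => //.
  + exact: subideals2_p_complete.
  + exact: subideals2_gap.
  + exact: subalgebras_family_inf.
- by move=> [C [CL chC cC gC fC]]; exists C; split=> // Y /CL/sub.
- move=> [C [CL _ [pC _] gC [C0 CT]]].
  split; first exact: subideals2_p_complete.
  apply: subideals2_gap; exact: frattini_semisimple_of_family gC C0 CT.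
- move=> [pG gG]; split; first exact: subalgebras_p_complete.
  apply: subalgebras_gap; apply: frattini_semisimple_of_family pG gG _ _ => //.
    exact: subalgebras_family_inf.
  exact: family_supT.
- move=> [pG gG]; apply: frattini_semisimple_of_family pG gG _ _ => //.
    exact: subalgebras_family_inf.
  by apply: family_supT; exact: sub.
Qed.
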